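(* Let a Lie group $G$ with Lie algebra $\mathfrak{g}$ act on a manifold $M$. The deformation cohomology of the action Lie groupoid $\mathcal{G}=G\ltimes M\rightrightarrows M$ fits into a long exact sequence $$\cdots\longrightarrow H^{k-1}(\mathcal{G},TM)\longrightarrow H^k_{\mathrm{def}}(\mathcal{G})\longrightarrow H^k(\mathcal{G},\mathfrak{g}_M)\xrightarrow{\ \rho_*\ }H^k(\mathcal{G},TM)\longrightarrow\cdots$$ where $\rho_*$ is induced by the infinitesimal action $\rho:\mathfrak{g}_M\to TM$.
   Context: Notation. For a Lie groupoid $\mathcal{G}\rightrightarrows M$, $s,t,m,u,i$ are the source, target, multiplication, unit and inversion; $gh$ is defined when $s(g)=t(h)$; $g:x\to y$ means $x=s(g)$, $y=t(g)$; $\mathcal{G}^{(k)}=\{(g_1,\dots,g_k): s(g_i)=t(g_{i+1})\}$; $\bar m(p,q)=pq^{-1}$ for $s(p)=s(q)$ (division map). For $g:x\to y$, $r_g$ and $l_g$ are the differentials of right translation $s^{-1}(y)\to s^{-1}(x)$ and left translation $t^{-1}(x)\to t^{-1}(y)$. The Lie algebroid $A$ has fibres $A_x=T_{1_x}s^{-1}(x)$ and anchor $\rho=dt|_A:A\to TM$. For $\alpha\in\Gamma(A)$ put $\overrightarrow{\alpha}(g)=r_g\alpha_{t(g)}$ and $\overleftarrow{\alpha}(g)=l_g(di(\alpha_{s(g)}))$. Deformation complex $(C^*_{\mathrm{def}}(\mathcal{G}),\delta)$ with cohomology $H^*_{\mathrm{def}}(\mathcal{G})$. For $k\ge 1$,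 $C^k_{\mathrm{def}}(\mathcal{G})$ consists of smooth maps $c:\mathcal{G}^{(k)}\to T\mathcal{G}$ with $c(g_1,\dots,g_k)\in T_{g_1}\mathcal{G}$ such that $ds(c(g_1,\dots,g_k))=:s_c(g_2,\dots,g_k)$ does not depend on $g_1$; and $$(\delta c)(g_1,\dots,g_{k+1})=-d\bar m\big(c(g_1g_2,g_3,\dots,g_{k+1}),c(g_2,\dots,g_{k+1})\big)+\sum_{i=2}^k(-1)^ic(g_1,\dots,g_ig_{i+1},\dots,g_{k+1})+(-1)^{k+1}c(g_1,\dots,g_k).$$ $C^0_{\mathrm{def}}(\mathcal{G})=\Gamma(A)$ and $\delta(\alpha)=\overrightarrow{\alpha}+\overleftarrow{\alpha}$. Differentiable cohomology. For a representation $E\to M$ of $\mathcal{G}$, $H^*(\mathcal{G},E)$ is the cohomology of the complex $C^k(\mathcal{G},E)$ of smooth maps $v:\mathcal{G}^{(k)}\to E$ with $v(g_1,\dots,g_k)\in E_{t(g_1)}$ ($C^0=\Gamma(E)$), with $(\delta v)(g_1,\dots,g_{k+1})=g_1\cdot v(g_2,\dots,g_{k+1})+\sum_{i=1}^k(-1)^iv(\dots,g_ig_{i+1},\dots)+(-1)^{k+1}v(g_1,\dots,g_k)$. Cohomology in negative degree is $0$. Action groupoid: arrows $G\times M$, $s(g,x)=x$, $t(g,x)=gx$, $(g,x)(h,y)=(gh,y)$ when $x=hy$. Its Lie algebroid is the trivial bundle $\mathfrak{g}_M=\mathfrak{g}\times M$ with anchor $\rho(v,x)=\frac{d}{d\epsilon}|_{\epsilon=0}\exp(\epsilon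 v)x$. Representations of $\mathcal{G}$ are $G$-equivariant vector bundles; $\mathfrak{g}_M$ carries the action induced by the adjoint action of $G$ on $\mathfrak{g}$, and $TM$ carries the action induced by differentiating the $G$-action on $M$. *)

(* Defs.v *)
From HB Require Import structures.
From mathcomp Require Import all_boot all_order all_algebra.
From mathcomp Require Import all_classical all_reals all_analysis.
Set Implicit Arguments.
Unset Strict Implicit.
Unset Printing Implicit Defensive.
Import Order.TTheory GRing.Theory Num.Theory.
Import numFieldNormedType.Exports.
Local Open Scope classical_set_scope.
Local Open Scope ring_scope.

Section Smoothness.
Variable R : realType.

(* C^k regularity on an open set U; iterating over all directions v covers
   all mixed partial derivatives. *)
Fixpoint Ck (k : nat) (n m : nat) (U : set 'rV[R]_n)
    (f : 'rV[R]_n -> 'rV[R]_m) : Prop :=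
  match k with
  | 0 => forall x, U x -> {for x, continuous f}
  | k'.+1 => (forall x, U x -> differentiable f x) /\
             (forall v, Ck k' U (fun x => 'D_v f x))
  end.

Definition Cinfty n m (U : set 'rV[R]_n) (f : 'rV[R]_n -> 'rV[R]_m) : Prop :=
  forall k, Ck k U f.

(* A space with an atlas indexed by its points: [chart x] is a chart around x,
   with domain [cdom x] and inverse [unchart x]; values outside the domains are
   irrelevant.  The axioms are in [is_manifold]. *)
Record charted := Charted {
  points :> topologicalType;
  mdim : nat;
  cdom : points -> set points;
  chart : points -> points -> 'rV[R]_mdim;
  unchart : points -> 'rV[R]_mdim -> points }.

Definition is_manifold (M : charted) : Prop :=
  [/\ hausdorff_space M,
      @second_countable M,
      forall x : M,
        [/\ open (cdom x) /\ cdom x x,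
            open (chart x @` cdom x),
            forall y, cdom x y -> unchart x (chart x y) = y,
            forall y, cdom x y -> {for y, continuous (chart x)} &
            forall y, cdom x y -> {for chart x y, continuous (unchart x)}] &
      forall x y : M,
        Cinfty (chart x @` (cdom x `&` cdom y)) (fun w => chart y (unchart x w))].

Record manifold := Manifold {
  mfd :> charted;
  manifoldP : is_manifold mfd }.

Definition euclid (n : nat) : charted :=
  @Charted 'rV[R]_n n (fun _ => setT) (fun _ => id) (fun _ => id).

Definition prodm (M N : charted) : charted :=
  @Charted (M * N)%type (mdim M + mdim N)
    (fun x => cdom x.1 `*` cdom x.2)
    (fun x y => row_mx (chart x.1 y.1) (chart x.2 y.2))
    (fun x w => (unchart x.1 (lsubmx w), unchart x.2 (rsubmx w))).

Definition smooth_at (N M : charted) (f : N -> M) (x : N) : Prop :=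
  exists U : set N,
    [/\ open U, U x, U `<=` cdom x,
        forall y, U y -> cdom (f x) (f y) &
        Cinfty (chart x @` U) (fun w => chart (f x) (f (unchart x w)))].

Definition smooth (N M : charted) (f : N -> M) : Prop :=
  forall x, smooth_at f x.

(* T_x M is 'rV_(mdim M) for every x: a tangent vector is represented by its
   coordinates in the chart [chart x].  [tmap f x] is d_x f : T_x N -> T_(f x) M. *)
Definition tmap (N M : charted) (f : N -> M) (x : N) (v : 'rV[R]_(mdim N))
    : 'rV[R]_(mdim M) :=
  'd (fun w => chart (f x) (f (unchart x w))) (chart x x) v.

(* Differential at x of a map f that is only meaningful on an embedded
   submanifold S containing x, evaluated at v tangent to S: computed on any
   smooth local extension of f (the result does not depend on it). *)
Definition tmap_on (N M : charted) (S : set N) (f : N -> M) (x : N)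
    (v : 'rV[R]_(mdim N)) : 'rV[R]_(mdim M) :=
  xget 0 [set w | exists F : N -> M,
    [/\ smooth_at F x, (\forall y \near x, S y -> F y = f y) & w = tmap F x v]].

(* A vector bundle whose fibre over every point is identified, as a vector
   space, with 'rV_rank; its smooth structure is given by trivializations
   [triv x] over [cdom x], [triv x y] being the one of the fibre over y. *)
Record vbundle (M : charted) := VBundle {
  rank : nat;
  triv : M -> M -> 'rV[R]_rank -> 'rV[R]_rank }.
Arguments triv {M} _ _ _ _.

Definition trivial_bundle (M : charted) (r : nat) : vbundle M :=
  @VBundle M r (fun _ _ => id).

(* [triv x y] takes the coordinates in [chart y] of a vector of T_y M to its
   coordinates in [chart x]. *)
Definition tangent_bundle (M : charted) : vbundle M :=
  @VBundle M (mdim M) (fun x y v => 'd (fun w => chart x (unchart y w)) (chart y y) v).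

(* [v], with v y in the fibre E_(f y), is smooth as a map from the subset S of N
   to the total space of E: locally it extends to a smooth map on N. *)
Definition smooth_along (N M : charted) (E : vbundle M) (S : set N)
    (f : N -> M) (v : N -> 'rV[R]_(rank E)) : Prop :=
  forall x, S x -> exists (F : N -> M) (V : N -> 'rV[R]_(rank E)),
    [/\ smooth_at F x,
        @smooth_at N (euclid (rank E)) (fun y => triv E (f x) (F y) (V y)) x &
        \forall y \near x, S y -> F y = f y /\ V y = v y].

End Smoothness.

Arguments smooth_along {R N M} E S f v.
Arguments triv {R M} _ _ _ _.

Section Cohomology.
Variable R : realType.

(* A cochain complex whose k-cochains are represented by the elements of
   [adm k], two of them being identified when their difference is in [nul k]
   (for groupoid cochains: when they agree on composable strings). *)
Record complex := Complex {
  cc : nat -> lmodType R;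
  adm : forall k, set (cc k);
  nul : forall k, set (cc k);
  cd : forall k, cc k -> cc k.+1 }.

Variable C : complex.

Definition cocycle k : set (cc C k) := [set z | adm z /\ nul (cd z)].

Definition coboundary k : set (cc C k) :=
  match k return set (cc C k) with
  | 0 => @nul C 0
  | k'.+1 => [set z | exists2 b : cc C k', adm b & nul (z - cd b)]
  end.

Definition cclass k (z : cc C k) : set (cc C k) :=
  [set z' | cocycle z' /\ coboundary (z' - z)].

Definition coh k : Type :=
  {x : set (cc C k) | exists2 z, cocycle z & x = cclass z}.

Definition mem_coh k (x : coh k) (z : cc C k) : Prop := sval x z.

Definition coh_is0 k (x : coh k) : Prop := mem_coh x 0.

(* z = a x + y in cohomology *)
Definition coh_lincomb k (a : R) (x y z : coh k) : Prop :=
  exists u v, [/\ mem_coh x u, mem_coh y v & mem_coh z (a *: u + v)].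

End Cohomology.

Definition coh_linear (R : realType) (C D : complex R) j k
    (f : coh C j -> coh D k) : Prop :=
  forall a x y z, coh_lincomb a x y z -> coh_lincomb a (f x) (f y) (f z).

Definition coh_induced (R : realType) (C D : complex R) j k
    (phi : cc C j -> cc D k) (f : coh C j -> coh D k) : Prop :=
  forall x z, mem_coh x z -> mem_coh (f x) (phi z).

Definition coh_exact (R : realType) (B C D : complex R) i j k
    (f : coh B i -> coh C j) (g : coh C j -> coh D k) : Prop :=
  forall y, coh_is0 (g y) <-> exists x, f x = y.

Section Groupoids.
Variable R : realType.

(* The data of a Lie groupoid that enters its complexes; the groupoid axioms are
   not needed to define them.  [gm g h] is the product gh and is irrelevant
   unless s g = t h. *)
Record groupoid := Groupoid {
  obj : charted R;
  arr : charted R;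
  gs : arr -> obj;
  gt : arr -> obj;
  gm : arr -> arr -> arr;
  gu : obj -> arr;
  gi : arr -> arr }.

(* A vector bundle E over the objects with gact g : E_(s g) -> E_(t g). *)
Record representation (H : groupoid) := Representation {
  rbundle :> vbundle (obj H);
  gact : arr H -> 'rV[R]_(rank rbundle) -> 'rV[R]_(rank rbundle) }.
Arguments gact {H} _ _ _.

Variable H : groupoid.

(* Strings (g_1, (g_2, ... (g_k, 0))) of k arrows, composable or not. *)
Fixpoint strings (k : nat) : charted R :=
  match k with
  | 0 => euclid R 0
  | k'.+1 => prodm (arr H) (strings k')
  end.

Fixpoint composable (k : nat) : set (strings k) :=
  match k return set (strings k) with
  | 0 => setT
  | k'.+1 =>
    match k' return set (strings k') -> set (strings k'.+1) with
    | 0 => fun _ => setT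
    | k''.+1 => fun P => [set g | gs g.1 = gt g.2.1 /\ P g.2]
    end (@composable k')
  end.

(* (g_1, ..., g_(k+2)) |-> (g_1, ..., g_(i+1) g_(i+2), ..., g_(k+2)), i <= k *)
Fixpoint gcontract (i k : nat) : strings k.+2 -> strings k.+1 :=
  match i with
  | 0 => fun g => (gm g.1 g.2.1, g.2.2)
  | i'.+1 =>
    match k return strings k.+2 -> strings k.+1 with
    | 0 => fun g => g.2
    | k'.+1 => fun g => (g.1, @gcontract i' k' g.2)
    end
  end.

Fixpoint droplast (k : nat) : strings k.+1 -> strings k :=
  match k return strings k.+1 -> strings k with
  | 0 => fun g => g.2
  | k'.+1 => fun g => (g.1, @droplast k' g.2)
  end.

(* [nset k], a subset of [nerve k], is the nerve H^(k), with H^(0) the objects. *)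
Definition nerve (k : nat) : charted R := if k is 0 then obj H else strings k.

Definition nset (k : nat) : set (nerve k) :=
  match k return set (nerve k) with
  | 0 => setT
  | k'.+1 => @composable k'.+1
  end.

(* (g_1, ..., g_k) |-> t(g_1), and x |-> x if k = 0 *)
Definition target (k : nat) : nerve k -> obj H :=
  match k return nerve k -> obj H with
  | 0 => id
  | k'.+1 => fun g => gt g.1
  end.

(* The complex C^*(H, E) of differentiable cohomology. *)

Definition rep_d (E : representation H) (k : nat) :
    (nerve k -> 'rV[R]_(rank E)) -> nerve k.+1 -> 'rV[R]_(rank E) :=
  match k return (nerve k -> 'rV[R]_(rank E)) ->
                 nerve k.+1 -> 'rV[R]_(rank E) with
  | 0 => fun v g => gact E g.1 (v (gs g.1)) - v (gt g.1)
  | k'.+1 => fun v g =>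
      gact E g.1 (v g.2)
      + \sum_(1 <= i < k'.+2) (-1) ^+ i *: v (@gcontract i.-1 k' g)
      + (-1) ^+ k'.+2 *: v (@droplast k'.+1 g)
  end.

Definition rep_complex (E : representation H) : complex R :=
  @Complex R (fun k => nerve k -> 'rV[R]_(rank E))
    (fun k v => smooth_along E (@nset k) (@target k) v)
    (fun k v => forall g, nset g -> v g = 0)
    (@rep_d E).

(* The deformation complex. *)

Definition dmbar (p q : arr H) (v w : 'rV[R]_(mdim (arr H))) :
    'rV[R]_(mdim (arr H)) :=
  @tmap_on R (prodm (arr H) (arr H)) (arr H)
    [set r | gs r.1 = gs r.2] (fun r => gm r.1 (gi r.2)) (p, q) (row_mx v w).

(* For al a section of A, A_x = ker (ds : T_(1_x) -> T_x) = T_(1_x) s^-1(x). *)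
Definition right_inv (al : obj H -> 'rV[R]_(mdim (arr H))) (g : arr H) :
    'rV[R]_(mdim (arr H)) :=
  tmap_on [set h | gs h = gt g] (fun h => gm h g) (gu (gt g)) (al (gt g)).

Definition left_inv (al : obj H -> 'rV[R]_(mdim (arr H))) (g : arr H) :
    'rV[R]_(mdim (arr H)) :=
  tmap_on [set h | gt h = gs g] (fun h => gm g h) (gi (gu (gs g)))
    (tmap (@gi H) (gu (gs g)) (al (gs g))).

Definition def_adm (k : nat) : set (nerve k -> 'rV[R]_(mdim (arr H))) :=
  match k return set (nerve k -> 'rV[R]_(mdim (arr H))) with
  | 0 => [set al | smooth_along (tangent_bundle (arr H)) setT (@gu H) al /\
                   forall x, tmap (@gs H) (gu x) (al x) = 0]
  | k'.+1 => [set c |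
      smooth_along (tangent_bundle (arr H)) (@composable k'.+1)
        (fun g => g.1) c /\
      forall g g' : strings k'.+1, composable g -> composable g' ->
        gs g.1 = gs g'.1 -> g.2 = g'.2 ->
        tmap (@gs H) g.1 (c g) = tmap (@gs H) g'.1 (c g')]
  end.

Definition def_d (k : nat) :
    (nerve k -> 'rV[R]_(mdim (arr H))) -> nerve k.+1 -> 'rV[R]_(mdim (arr H)) :=
  match k return (nerve k -> 'rV[R]_(mdim (arr H))) ->
                 nerve k.+1 -> 'rV[R]_(mdim (arr H)) with
  | 0 => fun al g => right_inv al g.1 + left_inv al g.1
  | k'.+1 => fun c g =>
      - dmbar (gm g.1 g.2.1) g.2.1 (c (@gcontract 0 k' g)) (c g.2)
      + \sum_(2 <= i < k'.+2) (-1) ^+ i *: c (@gcontract i.-1 k' g)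
      + (-1) ^+ k'.+2 *: c (@droplast k'.+1 g)
  end.

Definition def_complex : complex R :=
  @Complex R (fun k => nerve k -> 'rV[R]_(mdim (arr H)))
    def_adm
    (fun k c => forall g, nset g -> c g = 0)
    def_d.

End Groupoids.

Section Actions.
Variable R : realType.

Record lie_group := LieGroup {
  lgroup :> manifold R;
  lmul : lgroup -> lgroup -> lgroup;
  lone : lgroup;
  linv : lgroup -> lgroup;
  lmulA : forall g h k, lmul g (lmul h k) = lmul (lmul g h) k;
  lmul1g : forall g, lmul lone g = g;
  lmulVg : forall g, lmul (linv g) g = lone;
  lmul_smooth : @smooth R (prodm lgroup lgroup) lgroup (fun p => lmul p.1 p.2);
  linv_smooth : @smooth R lgroup lgroup linv }.

Record lie_action (G : lie_group) (M : manifold R) := LieAction {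
  lact :> G -> M -> M;
  lact1 : forall x, lact (lone G) x = x;
  lactM : forall g h x, lact (lmul g h) x = lact g (lact h x);
  lact_smooth : @smooth R (prodm G M) M (fun p => lact p.1 p.2) }.

Variables (G : lie_group) (M : manifold R) (a : lie_action G M).

Definition action_groupoid : groupoid R :=
  @Groupoid R M (prodm G M)
    (fun p => p.2)
    (fun p => a p.1 p.2)
    (fun p q => (lmul p.1 q.1, q.2))
    (fun x => (lone G, x))
    (fun p => (linv p.1, a p.1 p.2)).

(* The Lie algebra is T_e G; Ad g is the differential at e of conjugation. *)
Definition Ad (g : G) (v : 'rV[R]_(mdim G)) : 'rV[R]_(mdim G) :=
  @tmap R G G (fun h => lmul (lmul g h) (linv g)) (lone G) v.

Definition rep_g : representation action_groupoid :=
  @Representation R action_groupoid (trivial_bundle M (mdim G))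
    (fun p v => Ad p.1 v).

Definition rep_T : representation action_groupoid :=
  @Representation R action_groupoid (tangent_bundle M)
    (fun p v => @tmap R M M (a p.1) p.2 v).

(* The infinitesimal action at x, i.e. the anchor dt of the Lie algebroid, whose
   fibre at x is identified with T_e G through v |-> (v, 0) in T_(e, x) (G x M). *)
Definition inf_action (x : M) (v : 'rV[R]_(mdim G)) : 'rV[R]_(mdim M) :=
  @tmap R (prodm G M) M (@gt R action_groupoid) (@gu R action_groupoid x)
    (row_mx v 0).

Definition inf_action_cochain (k : nat) :
    cc (rep_complex rep_g) k -> cc (rep_complex rep_T) k :=
  fun v g => inf_action (target g) (v g).

End Actions.

(* Main.v *)
From HB Require Import structures.
Require Import Defs.
From mathcomp Require Import all_boot all_order all_algebra.
From mathcomp Require Import all_classical all_reals all_analysis.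

(* Right translation trivializes T G, so a deformation cochain c of degree k of
   the action groupoid is a pair (v, w): its G-component, translated to the unit,
   is a cochain v with values in g_M, and its M-component ds(c), which does not
   depend on g_1, is a cochain w of degree k - 1 with values in T M.
   Differentiating the division map (p, q) |-> p q^-1 gives
   delta(v, w) = (delta v, - rho v - delta w); hence the deformation complex is
   the mapping cone of rho : C^*(g_M) -> C^*(T M), up to sign and shift, and the
   sequence is the long exact sequence of this cone. *)

Set Implicit Arguments.
Unset Strict Implicit.
Unset Printing Implicit Defensive.
Import Order.TTheory GRing.Theory Num.Theory.
Import numFieldNormedType.Exports.
Local Open Scope classical_set_scope.
Local Open Scope ring_scope.

(** * Differentials *)

Section Calculus.
Context {R : realType}.

(** Two features of the encoding shape the proof. A tangent vector at [y] is written in the chart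
    chosen at [y], and this chart may jump as [y] moves; a field [y |-> v y] can be seen to be
    smooth only after passing to one fixed chart, which is the work of [tchart]. Moreover [dmbar],
    [right_inv] and [left_inv] differentiate maps living on submanifolds through an unspecified
    smooth extension. For an action groupoid the formulas for division and translation are smooth on
    the whole product, so they are extensions of themselves, and any other extension agrees with
    them along a curve inside the submanifold. The shape of the cone differential comes from p q^-1
    = (g h^-1, h x) for p = (g, x), q = (h, x). The point h x moves with h as well as with x, which
    produces the term rho v next to the action on w. Inversion turns right translations into left
    ones, and L_g = R_g Ad_g brings them back to the right; this is how the adjoint action enters
    delta v. *)

Lemma scale_is_bilinear (W : normedModType R) :
  bilinear_for
    (GRing.Scale.Law.clone _ _ *:%R _) (GRing.Scale.Law.clone _ _ *:%R _)
    (@GRing.scale R W).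
Proof.
split=> [u'|u] a x y /=.
- by rewrite scalerDl scalerA.
- by rewrite scalerDr !scalerA mulrC.
Qed.

HB.instance Definition _ (W : normedModType R) :=
  bilinear_isBilinear.Build R R W W _ _ (@GRing.scale R W) (@scale_is_bilinear W).

Lemma is_diff_scale (V W : normedModType R) (f : V -> R) (g : V -> W) x :
  differentiable f x -> differentiable g x ->
  is_diff x (fun y => f y *: g y) (fun v => f x *: 'd g x v + 'd f x v *: g x).
Proof.
move=> df dg.
have sc : continuous (fun p : R * W => p.1 *: p.2) by exact: scale_continuous.
have dp := differentiable_pair df dg.
have ds : differentiable (fun p : R * W => p.1 *: p.2) (f x, g x).
  exact: (@differentiable_bilin _ _ _ _ (@GRing.scale R W)).
have -> : (fun y => f y *: g y) =
    (fun p : R * W => p.1 *: p.2) \o (fun y => (f y, g y)) by [].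
split; first exact: differentiable_comp.
rewrite diff_comp// (@diff_bilin _ _ _ _ (@GRing.scale R W))// diff_pair//.
Qed.

Lemma differentiable_mxcoord (V : normedModType R) m n (f : V -> 'M[R]_(m, n)) i j x :
  differentiable f x -> differentiable (fun y => f y i j : R) x.
Proof.
move=> df.
exact: (differentiable_comp df (differentiable_coord _ _ _)).
Qed.

Lemma diff_mxcoord (V : normedModType R) m n (f : V -> 'M[R]_(m, n)) i j x v :
  differentiable f x -> 'd (fun y => f y i j : R) x v = ('d f x v) i j.
Proof.
move=> df.
have dc := @differentiable_coord R m n (f x) i j.
rewrite -[LHS]deriveE; last exact: differentiable_mxcoord.
rewrite -[in RHS]deriveE// derive_mx ?mxE//; exact: diff_derivable.
Qed.

Lemma differentiable_coordZ (V W : normedModType R) p (f : V -> 'rV[R]_p) j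
    (g : V -> W) x :
  differentiable f x -> differentiable g x ->
  differentiable (fun y => f y 0 j *: g y) x.
Proof.
move=> df dg.
by case: (is_diff_scale (differentiable_mxcoord 0 j df) dg) => d _; exact: d.
Qed.

Lemma derive_coordZ (V W : normedModType R) p (f : V -> 'rV[R]_p) j
    (g : V -> W) x v :
  differentiable f x -> differentiable g x ->
  'D_v (fun y => f y 0 j *: g y) x = f x 0 j *: 'D_v g x + ('D_v f x) 0 j *: g x.
Proof.
move=> df dg; case: (is_diff_scale (differentiable_mxcoord 0 j df) dg) => _ d.
rewrite !deriveE//; last exact: differentiable_coordZ.
by rewrite d diff_mxcoord.
Qed.

(** The base point of [g] is a variable [y] tied to [f x] by an equation: for charts, [f x]
    simplifies only through [chartK], and rewriting under ['d] is thereby avoided. *)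
Lemma differentiable_funcomp (U V W : normedModType R) (f : U -> V) (g : V -> W) x y :
  f x = y -> differentiable f x -> differentiable g y ->
  differentiable (fun z => g (f z)) x.
Proof. by move=> <-; exact: differentiable_comp. Qed.

Lemma diff_funcomp (U V W : normedModType R) (f : U -> V) (g : V -> W) x y v :
  f x = y -> differentiable f x -> differentiable g y ->
  'd (fun z => g (f z)) x v = 'd g y ('d f x v).
Proof. by move=> <- df dg; rewrite (diff_comp df dg). Qed.

Lemma linear_rV_sum n (W : lmodType R) (f : {linear 'rV[R]_n -> W}) x :
  f x = \sum_j x 0 j *: f 'e_j.
Proof.
by rewrite {1}[x]row_sum_delta linear_sum; apply: eq_bigr => j _; rewrite linearZ.
Qed.

Lemma continuous_sum_seq (T : topologicalType) (W : normedModType R) (I : Type)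
    (r : seq I) (F : I -> T -> W) x :
  (forall i, {for x, continuous (F i)}) ->
  {for x, continuous (fun y => \sum_(i <- r) F i y)}.
Proof.
move=> cF; elim: r => [|i r IH].
  rewrite (_ : (fun _ => _) = cst 0); last by apply/funext => y; rewrite big_nil.
  exact: cvg_cst.
rewrite (_ : (fun _ => _) = F i + (fun y => \sum_(j <- r) F j y)).
  exact: continuousD.
by apply/funext => y; rewrite big_cons.
Qed.

Lemma linear_rV_continuous n (W : normedModType R) (f : {linear 'rV[R]_n -> W}) :
  continuous f.
Proof.
have -> : (f : _ -> _) = (fun x => \sum_j x 0 j *: f 'e_j).
  by apply/funext => x; exact: linear_rV_sum.
move=> x; apply: continuous_sum_seq => j.
apply: cvgZr_tmp; [exact: nbhs_filter|exact: (@coord_continuous R 1 n 0 j x)].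
Qed.

(** The first-order expansion of [f] at [x] is also one of [g], and uniqueness of the differential
    turns it into differentiability of [g]. *)
Lemma near_eq_differentiable (V W : normedModType R) (f g : V -> W) x :
  (\near x, f x = g x) -> differentiable f x -> differentiable g x.
Proof.
move=> fg df.
have fgx : f x = g x by exact: (nbhs_singleton fg).
have H : g \o shift x = cst (g x) + 'd f x +o_ (0 : V) id.
  apply/eqaddoP => e e0.
  move/diff_locallyP : (df) => [_ /eqaddoP/(_ e e0)].
  have : \forall y \near (0 : V), f (y + x) = g (y + x).
    by rewrite (near_shift x)/=; near do rewrite /= sub0r subrK//.
  move=> h1; apply: filterS2 h1 => y /= h1.
  by rewrite /= fctE/= !fctE /= h1 -fgx.
have dg : 'd g x = 'd f x :> (V -> W).
  by apply: diff_unique => //; exact: diff_continuous.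
by apply/diff_locallyP; rewrite dg; split=> //; exact: diff_continuous.
Unshelve. all: by end_near. Qed.

Lemma near_eq_diff (V W : normedModType R) (f g : V -> W) x v :
  (\near x, f x = g x) -> differentiable f x -> 'd f x v = 'd g x v.
Proof.
move=> fg df.
by rewrite -!deriveE//; [exact: near_eq_derive|exact: near_eq_differentiable df].
Qed.
End Calculus.

(** * Smooth maps between spaces of row vectors *)

(* The next lemmas are stated over an abstract [topologicalType]: applying the
   filter lemmas directly at a matrix type makes unification unfold [nbhs]. *)
Lemma near_continuous (T U : topologicalType) (f g : T -> U) (x : T) :
  (\near x, f x = g x) -> {for x, continuous f} -> {for x, continuous g}.
Proof.
move=> fg; rewrite /prop_for /continuous_at -(nbhs_singleton fg) => cf.
by apply: cvg_trans cf; exact: near_eq_cvg.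
Qed.

Lemma open_near (T : topologicalType) (U : set T) (P : T -> Prop) (x : T) :
  open U -> U x -> (forall y, U y -> P y) -> \near x, P x.
Proof. by move=> oU Ux UP; apply: filterS (open_nbhs_nbhs (conj oU Ux)). Qed.

Lemma near_imp (T : topologicalType) (P Q : T -> Prop) (x : T) :
  (forall y, P y -> Q y) -> (\near x, P x) -> \near x, Q x.
Proof. by move=> PQ; apply: filterS. Qed.

Lemma near_imp2 (T : topologicalType) (P Q S : T -> Prop) (x : T) :
  (forall y, P y -> Q y -> S y) ->
  (\near x, P x) -> (\near x, Q x) -> \near x, S x.
Proof. by move=> PQ; apply: filterS2. Qed.

Lemma near_imp3 (T : topologicalType) (P Q Q' S : T -> Prop) (x : T) :
  (forall y, P y -> Q y -> Q' y -> S y) ->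
  (\near x, P x) -> (\near x, Q x) -> (\near x, Q' x) -> \near x, S x.
Proof. by move=> PQ; apply: filterS3. Qed.

Lemma continuous_pair_at (T U V : topologicalType) (f : T -> U) (g : T -> V) (x : T) :
  {for x, continuous f} -> {for x, continuous g} ->
  {for x, continuous (fun y => (f y, g y))}.
Proof. exact: cvg_pair. Qed.

Lemma near_open_nbhs (T : topologicalType) (P : set T) (x : T) :
  (\near x, P x) -> exists2 U : set T, open_nbhs x U & U `<=` P.
Proof. by rewrite /prop_near1 nbhsE => -[U oU UP]; exists U. Qed.

(** Pairing is a sum of two linear maps, so its continuity and smoothness reduce to those of sums
    and linear maps. *)
Lemma row_mx_linear (R : realType) m p (u : 'rV[R]_m) (v : 'rV[R]_p) :
  row_mx u v = u *m (row_mx 1%:M 0 : 'M[R]_(m, m + p))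
             + v *m (row_mx 0 1%:M : 'M[R]_(p, m + p)).
Proof. by rewrite !mul_mx_row !mulmx1 !mulmx0 add_row_mx addr0 add0r. Qed.

Lemma continuous_row_mx (R : realType) (T : topologicalType) m p
    (f : T -> 'rV[R]_m) (g : T -> 'rV[R]_p) (x : T) :
  {for x, continuous f} -> {for x, continuous g} ->
  {for x, continuous (fun y => row_mx (f y) (g y))}.
Proof.
move=> cf cg.
rewrite (_ : (fun y => _) = (fun y => f y *m (row_mx 1%:M 0 : 'M[R]_(m, m + p)))
    + (fun y => g y *m (row_mx 0 1%:M : 'M[R]_(p, m + p)))); last first.
  by apply/funext => y; exact: row_mx_linear.
apply: continuousD.
  have := @linear_rV_continuous R m _ (mulmxr (row_mx 1%:M 0 : 'M[R]_(m, m + p))) (f x).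
  exact: continuous_comp.
have := @linear_rV_continuous R p _ (mulmxr (row_mx 0 1%:M : 'M[R]_(p, m + p))) (g x).
exact: continuous_comp.
Qed.

Section CkCalculus.
Context {R : realType}.
Implicit Types n m p : nat.

Lemma Ck_ext k n m (U : set 'rV[R]_n) (f g : 'rV[R]_n -> 'rV[R]_m) :
  open U -> (forall x, U x -> f x = g x) -> Ck k U f -> Ck k U g.
Proof.
move=> oU; elim: k m f g => [|k IH] m f g fg /=.
  by move=> cf x Ux; apply: near_continuous (cf x Ux); exact: open_near fg.
move=> [df cf]; split=> [x Ux|v].
  by apply: near_eq_differentiable (df x Ux); exact: open_near fg.
apply: IH (cf v) => x Ux; apply: near_eq_derive; exact: open_near fg.
Qed.

Lemma Ck_sub k n m (U W : set 'rV[R]_n) (f : 'rV[R]_n -> 'rV[R]_m) :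
  W `<=` U -> Ck k U f -> Ck k W f.
Proof.
move=> WU; elim: k m f => [|k IH] m f /=; first by move=> cf x /WU; exact: cf.
by move=> [df cf]; split=> [x /WU/df//|v]; apply: IH.
Qed.

Lemma Ck_pred k n m (U : set 'rV[R]_n) (f : 'rV[R]_n -> 'rV[R]_m) :
  Ck k.+1 U f -> Ck k U f.
Proof.
elim: k m f => [|k IH] m f; first by move=> [df _] x /df/differentiable_continuous.
by move=> [df cf]; split=> // v; apply: IH; exact: cf.
Qed.

Lemma Ck_cst k n m (U : set 'rV[R]_n) (c : 'rV[R]_m) : Ck k U (cst c).
Proof.
elim: k c => [|k IH] c /=; first by move=> x _; exact: cst_continuous.
split=> [x _|v]; first exact: differentiable_cst.
rewrite (_ : (fun x => _) = cst 0)//; apply/funext => x; exact: derive_cst.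
Qed.

Lemma Ck_linear k n m (U : set 'rV[R]_n) (f : {linear 'rV[R]_n -> 'rV[R]_m}) :
  Ck k U f.
Proof.
have cf := @linear_rV_continuous _ _ _ f.
case: k => [|k] /=; first by move=> x _; exact: cf.
split=> [x _|v]; first exact: linear_differentiable.
rewrite (_ : (fun x => _) = cst (f v)); first exact: Ck_cst.
by apply/funext => x; rewrite deriveE ?diff_lin//; exact: linear_differentiable.
Qed.

Lemma Ck_add k n m (U : set 'rV[R]_n) (f g : 'rV[R]_n -> 'rV[R]_m) :
  open U -> Ck k U f -> Ck k U g -> Ck k U (fun x => f x + g x).
Proof.
move=> oU; elim: k m f g => [|k IH] m f g /=.
  by move=> cf cg x Ux; apply: continuousD; [exact: cf|exact: cg].
move=> [df cf] [dg cg]; split=> [x Ux|v].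
  by apply: differentiableD; [exact: df|exact: dg].
apply: Ck_ext (IH _ _ _ (cf v) (cg v)) => // x Ux.
by rewrite -deriveD//; apply: diff_derivable; [exact: df|exact: dg].
Qed.

(** By the product rule the derivative is a sum of two products of lower order. The scalar factor
    appears as a coordinate of [f] because [Ck] speaks of row vectors only. *)
Lemma Ck_scale k n m p (U : set 'rV[R]_n) (f : 'rV[R]_n -> 'rV[R]_p) j
    (g : 'rV[R]_n -> 'rV[R]_m) :
  open U -> Ck k U f -> Ck k U g -> Ck k U (fun x => f x 0 j *: g x).
Proof.
move=> oU; elim: k m f g => [|k IH] m f g.
  move=> cf cg x Ux; apply: continuousZ; last exact: cg.
  apply: (@continuous_comp _ _ _ f (fun y : 'rV[R]_p => y 0 j)); first exact: cf.
  exact: (@coord_continuous R 1 p 0 j (f x)).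
move=> Cf Cg; have [df cf] := Cf; have [dg cg] := Cg.
split=> [x Ux|v]; first by apply: differentiable_coordZ; [exact: df|exact: dg].
apply: (@Ck_ext _ _ _ _ (fun x => f x 0 j *: 'D_v g x + ('D_v f x) 0 j *: g x)) => //.
  by move=> x Ux; rewrite derive_coordZ//; [exact: df|exact: dg].
apply: Ck_add => //; apply: IH; [exact: Ck_pred|exact: cg|exact: cf|exact: Ck_pred].
Qed.

Lemma Ck_sum k n m (I : Type) (r : seq I) (U : set 'rV[R]_n)
    (f : I -> 'rV[R]_n -> 'rV[R]_m) :
  open U -> (forall i, Ck k U (f i)) -> Ck k U (fun x => \sum_(i <- r) f i x).
Proof.
move=> oU cf; elim: r => [|i r IH].
  by rewrite (_ : (fun _ => _) = cst 0);
    [exact: Ck_cst|apply/funext => x; rewrite big_nil].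
rewrite (_ : (fun _ => _) = fun x => f i x + \sum_(j <- r) f j x).
  exact: Ck_add.
by apply/funext => x; rewrite big_cons.
Qed.

Lemma diff_rV_sum n m (f : 'rV[R]_n -> 'rV[R]_m) y u :
  differentiable f y -> 'd f y u = \sum_j u 0 j *: 'D_('e_j) f y.
Proof.
by move=> df; rewrite linear_rV_sum; apply: eq_bigr => j _; rewrite deriveE.
Qed.

(** The chain rule in coordinates writes ['D_v (g o f)] as a sum of products of coordinates of
    ['D_v f] with partial derivatives of [g] composed with [f]. The induction leaves [g] free
    because it recurs on these partial derivatives. *)
Lemma Ck_comp k n m p (U : set 'rV[R]_n) (W : set 'rV[R]_m)
    (f : 'rV[R]_n -> 'rV[R]_m) (g : 'rV[R]_m -> 'rV[R]_p) :
  open U -> (forall x, U x -> W (f x)) -> Ck k U f -> Ck k W g ->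
  Ck k U (fun x => g (f x)).
Proof.
move=> oU fUW; elim: k p g => [|k IH] p g.
  move=> cf cg x Ux; apply: continuous_comp; [exact: cf|apply: cg; exact: fUW].
move=> Cf Cg; have [df cf] := Cf; have [dg cg] := Cg.
split=> [x Ux|v].
  by move: (df x Ux) (dg _ (fUW x Ux)); exact: differentiable_funcomp erefl.
apply: (@Ck_ext _ _ _ _ (fun x => \sum_j ('D_v f x) 0 j *: 'D_('e_j) g (f x))) => //.
  move=> x Ux; have dfx := df x Ux; have dgx := dg _ (fUW x Ux).
  rewrite [RHS]deriveE; last exact: differentiable_funcomp erefl dfx dgx.
  by rewrite (diff_funcomp _ erefl dfx dgx) (diff_rV_sum _ dgx) deriveE.
apply: Ck_sum => // j; apply: Ck_scale; [exact: oU|exact: cf|].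
by apply: (IH _ ('D_('e_j) g)) (cg _); exact: Ck_pred.
Qed.

End CkCalculus.

Section CinftyAt.
Context {R : realType}.
Implicit Types n m p : nat.

(** Smoothness of a germ, with one neighbourhood for all orders; domains are intersected once in the
    closure lemmas and disappear from later arguments. *)
Definition Cinfty_at n m (f : 'rV[R]_n -> 'rV[R]_m) (x : 'rV[R]_n) : Prop :=
  exists2 U, open_nbhs x U & Cinfty U f.

(** Every clause of [Ck] is a condition at single points of [U], so the neighbourhood may vary with
    the point. *)
Lemma Cinfty_local n m (U : set 'rV[R]_n) (f : 'rV[R]_n -> 'rV[R]_m) :
  (forall x, U x -> Cinfty_at f x) -> Cinfty U f.
Proof.
move=> cf k; have {cf} : forall x, U x -> exists2 W, W x & Ck k W f.
  by move=> x /cf [W [_ Wx] cW]; exists W.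
elim: k m f => [|k IH] m f cf /=; first by move=> x /cf[W Wx]; apply.
split=> [x /cf[W Wx [df _]]|v]; first exact: df.
by apply: IH => x /cf[W Wx [_ cW]]; exists W => //; exact: cW.
Qed.

Lemma Cinfty_at_ext n m (f g : 'rV[R]_n -> 'rV[R]_m) x :
  (\near x, f x = g x) -> Cinfty_at f x -> Cinfty_at g x.
Proof.
move=> /near_open_nbhs [W [oW Wx] fg] [U [oU Ux] cf].
have oUW : open (U `&` W) by exact: openI.
exists (U `&` W) => // k; apply: (Ck_ext oUW) (Ck_sub _ (cf k)); last by move=> y [].
by move=> y [_ /fg].
Qed.

Lemma Cinfty_at_near n m (f : 'rV[R]_n -> 'rV[R]_m) x :
  Cinfty_at f x -> \near x, Cinfty_at f x.
Proof.
move=> [U [oU Ux] cf]; apply: (open_near oU Ux) => y Uy.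
by exists U.
Qed.

Lemma Cinfty_at_differentiable n m (f : 'rV[R]_n -> 'rV[R]_m) x :
  Cinfty_at f x -> differentiable f x.
Proof. by move=> [U [_ Ux] /(_ 1%N) [df _]]; exact: df. Qed.

Lemma Cinfty_at_continuous n m (f : 'rV[R]_n -> 'rV[R]_m) x :
  Cinfty_at f x -> {for x, continuous f}.
Proof. by move=> /Cinfty_at_differentiable/differentiable_continuous. Qed.

Lemma Cinfty_at_cst n m (c : 'rV[R]_m) (x : 'rV[R]_n) : Cinfty_at (cst c) x.
Proof. by exists setT; [split=> //; exact: openT|move=> k; exact: Ck_cst]. Qed.

Lemma Cinfty_at_linear n m (f : {linear 'rV[R]_n -> 'rV[R]_m}) x : Cinfty_at f x.
Proof. by exists setT; [split=> //; exact: openT|move=> k; exact: Ck_linear]. Qed.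

Lemma Cinfty_at_add n m (f g : 'rV[R]_n -> 'rV[R]_m) x :
  Cinfty_at f x -> Cinfty_at g x -> Cinfty_at (fun y => f y + g y) x.
Proof.
move=> [U [oU Ux] cf] [W [oW Wx] cg].
have oUW : open (U `&` W) by exact: openI.
exists (U `&` W) => // k.
by apply: Ck_add => //; [apply: Ck_sub (cf k)|apply: Ck_sub (cg k)] => y [].
Qed.

Lemma Cinfty_at_scale n m p (f : 'rV[R]_n -> 'rV[R]_p) j (g : 'rV[R]_n -> 'rV[R]_m) x :
  Cinfty_at f x -> Cinfty_at g x -> Cinfty_at (fun y => f y 0 j *: g y) x.
Proof.
move=> [U [oU Ux] cf] [W [oW Wx] cg].
have oUW : open (U `&` W) by exact: openI.
exists (U `&` W) => // k.
by apply: Ck_scale => //; [apply: Ck_sub (cf k)|apply: Ck_sub (cg k)] => y [].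
Qed.

Lemma Cinfty_at_sum n m (I : Type) (r : seq I) (f : I -> 'rV[R]_n -> 'rV[R]_m) x :
  (forall i, Cinfty_at (f i) x) -> Cinfty_at (fun y => \sum_(i <- r) f i y) x.
Proof.
move=> cf; elim: r => [|i r IH].
  by apply: (Cinfty_at_ext _ (Cinfty_at_cst 0 x)); near=> y; rewrite big_nil.
apply: (Cinfty_at_ext _ (Cinfty_at_add (cf i) IH)).
by near=> y; rewrite big_cons.
Unshelve. all: by end_near. Qed.

Lemma Cinfty_at_comp n m p (f : 'rV[R]_n -> 'rV[R]_m) (g : 'rV[R]_m -> 'rV[R]_p) x :
  Cinfty_at f x -> Cinfty_at g (f x) -> Cinfty_at (fun y => g (f y)) x.
Proof.
move=> Cf [W oW cg].
have [V [oV Vx] VW] :=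
  near_open_nbhs (Cinfty_at_continuous Cf (open_nbhs_nbhs oW)).
move: Cf => [U [oU Ux] cf].
have oUW : open (U `&` V) by exact: openI.
exists (U `&` V) => // k; apply: (Ck_comp oUW) (cg k).
  by move=> y [_ /VW].
by apply: Ck_sub (cf k) => y [].
Qed.

(** Both the base point and the vector move. Expanding ['d g] in partial derivatives, valid near
    [f x] where [g] is differentiable, leaves a sum of products of smooth functions. *)
Lemma Cinfty_at_diff n m p (f : 'rV[R]_n -> 'rV[R]_m) (u : 'rV[R]_n -> 'rV[R]_m)
    (g : 'rV[R]_m -> 'rV[R]_p) x :
  Cinfty_at f x -> Cinfty_at u x -> Cinfty_at g (f x) ->
  Cinfty_at (fun y => 'd g (f y) (u y)) x.
Proof.
move=> Cf Cu Cg.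
apply: (@Cinfty_at_ext _ _ (fun y => \sum_j u y 0 j *: 'D_('e_j) g (f y))).
  apply: near_imp (Cinfty_at_continuous Cf (Cinfty_at_near Cg)).
  by move=> y /= Cgy; rewrite (diff_rV_sum _ (Cinfty_at_differentiable Cgy)).
apply: Cinfty_at_sum => j; apply: Cinfty_at_scale => //.
apply: (Cinfty_at_comp (g := 'D_('e_j) g)) => //.
have [U oU cg] := Cg; exists U => // k; exact: (cg k.+1).2.
Qed.

Lemma Cinfty_at_row_mx n m p (f : 'rV[R]_n -> 'rV[R]_m) (g : 'rV[R]_n -> 'rV[R]_p) x :
  Cinfty_at f x -> Cinfty_at g x -> Cinfty_at (fun y => row_mx (f y) (g y)) x.
Proof.
move=> Cf Cg.
have C1 : Cinfty_at (fun y => f y *m (row_mx 1%:M 0 : 'M[R]_(m, m + p))) x.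
  exact: (Cinfty_at_comp Cf (Cinfty_at_linear (mulmxr _) _)).
have C2 : Cinfty_at (fun y => g y *m (row_mx 0 1%:M : 'M[R]_(p, m + p))) x.
  exact: (Cinfty_at_comp Cg (Cinfty_at_linear (mulmxr _) _)).
apply: (Cinfty_at_ext _ (Cinfty_at_add C1 C2)); near=> y.
by rewrite row_mx_linear.
Unshelve. all: by end_near. Qed.

End CinftyAt.

(** * Smooth maps and tangent maps in charts *)

Section Charts.
Context {R : realType}.

(** The chart axioms of [is_manifold] by themselves, in a form that also covers [euclid] and
    [prodm], hence strings of arrows. *)
Definition has_atlas (M : charted R) : Prop :=
  (forall x : M,
     [/\ open (cdom x) /\ cdom x x,
         open (chart x @` cdom x),
         forall y, cdom x y -> unchart x (chart x y) = y,
         forall y, cdom x y -> {for y, continuous (chart x)} &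
         forall y, cdom x y -> {for chart x y, continuous (unchart x)}]) /\
  (forall x y : M,
     Cinfty (chart x @` (cdom x `&` cdom y)) (fun w => chart y (unchart x w))).

Lemma manifold_atlas (M : manifold R) : has_atlas M.
Proof. by case: (manifoldP M). Qed.

Lemma near_Cinfty_at n m (U : set 'rV[R]_n) (f : 'rV[R]_n -> 'rV[R]_m) x :
  (\near x, U x) -> Cinfty U f -> Cinfty_at f x.
Proof.
move=> /near_open_nbhs[W oW WU] cf; exists W => // k; exact: Ck_sub (cf k).
Qed.

Section OneManifold.
Variables (M : charted R) (aM : has_atlas M).

Lemma chart_dom (x : M) : cdom x x.
Proof. by have [[_]] := aM.1 x. Qed.

Lemma near_cdom (x y : M) : cdom x y -> \forall z \near y, cdom x z.
Proof. by have [[oD _] _ _ _ _] := aM.1 x => xy; exact: open_near oD xy _. Qed.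

Lemma near_cdom_self (x : M) : \forall z \near x, cdom x z.
Proof. exact/near_cdom/chart_dom. Qed.

Lemma chartK (x y : M) : cdom x y -> unchart x (chart x y) = y.
Proof. by have [_ _ + _ _] := aM.1 x; apply. Qed.

Lemma unchart_self (x : M) : unchart x (chart x x) = x.
Proof. exact/chartK/chart_dom. Qed.

Lemma chart_continuous (x y : M) : cdom x y -> {for y, continuous (chart x)}.
Proof. by have [_ _ _ + _] := aM.1 x; apply. Qed.

Lemma unchart_continuous (x y : M) :
  cdom x y -> {for chart x y, continuous (unchart x)}.
Proof. by have [_ _ _ _ +] := aM.1 x; apply. Qed.

Lemma near_unchart (x y : M) (P : M -> Prop) : cdom x y ->
  (\near y, P y) -> \forall w \near chart x y, P (unchart x w).
Proof.
move=> xy Py; have := unchart_continuous xy; rewrite /prop_for /continuous_at.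
by rewrite chartK// => /(_ _ Py).
Qed.

Lemma near_chart (x y : M) (P : 'rV[R]_(mdim M) -> Prop) : cdom x y ->
  (\forall w \near chart x y, P w) -> \forall z \near y, P (chart x z).
Proof. by move=> xy Py; exact: (chart_continuous xy Py). Qed.

Lemma near_unchartK (x y : M) : cdom x y ->
  \forall w \near chart x y, chart x (unchart x w) = w.
Proof.
move=> xy; have [_ oI _ _ _] := aM.1 x.
apply: (open_near oI); first by exists y.
by move=> _ [z xz <-]; rewrite chartK.
Qed.

Lemma near_chart_image (x y : M) (U : set M) : cdom x y ->
  (\near y, U y) -> \forall w \near chart x y, (chart x @` U) w.
Proof.
move=> xy Uy; apply: near_imp2 (near_unchart xy Uy) (near_unchartK xy).
by move=> w Uw <-; exists (unchart x w).
Qed.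

Lemma Cinfty_at_transition (x y z : M) : cdom x z -> cdom y z ->
  Cinfty_at (fun w => chart y (unchart x w)) (chart x z).
Proof.
move=> xz yz; apply: near_Cinfty_at (aM.2 x y).
by apply: near_chart_image => //; apply: near_imp2 (near_cdom xz) (near_cdom yz).
Qed.

End OneManifold.

Lemma euclid_atlas n : has_atlas (euclid R n).
Proof.
split=> [x|x y k].
  split=> //=; first by split=> //; exact: openT.
  - by rewrite image_id; exact: openT.
  - by move=> y _; exact: cvg_id.
  - by move=> y _; exact: cvg_id.
rewrite (_ : (fun w => _) = idfun)//; exact: Ck_linear.
Qed.

Lemma nbhs_prod (S T : topologicalType) (P : S -> Prop) (Q : T -> Prop) (x : S) (y : T) :
  (\near x, P x) -> (\near y, Q y) -> \forall z \near (x, y), P z.1 /\ Q z.2.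
Proof. by move=> Px Qy; exists (P, Q). Qed.

Lemma prodm_atlas (M N : charted R) :
  has_atlas M -> has_atlas N -> has_atlas (prodm M N).
Proof.
move=> aM aN; split=> [x|x y].
  have [[oD Dx] oI cK ccont ucont] := aM.1 x.1.
  have [[oD' Dx'] oI' cK' ccont' ucont'] := aN.1 x.2.
  split.
  - split; last by split.
    by rewrite openE => -[y z] [/= xy xz]; exact: nbhs_prod (near_cdom aM xy) (near_cdom aN xz).
  - rewrite openE => _ [[y z] [/= xy xz] <-] /=.
    have L : {for row_mx (chart x.1 y) (chart x.2 z), continuous (@lsubmx R 1 (mdim M) (mdim N))}.
      exact: continuous_lsubmx.
    have K : {for row_mx (chart x.1 y) (chart x.2 z), continuous (@rsubmx R 1 (mdim M) (mdim N))}.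
      exact: continuous_rsubmx.
    move: L K; rewrite /prop_for /continuous_at row_mxKl row_mxKr => L K.
    have oy : (chart x.1 @` cdom x.1) (chart x.1 y) by exists y.
    have oz : (chart x.2 @` cdom x.2) (chart x.2 z) by exists z.
    have H1 := L _ (open_nbhs_nbhs (conj oI oy)).
    have H2 := K _ (open_nbhs_nbhs (conj oI' oz)).
    apply: near_imp2 H1 H2 => w /= [y' xy' E1] [z' xz' E2].
    by exists (y', z'); [split|rewrite /= E1 E2 hsubmxK].
  - by move=> [y z] [/= xy xz]; rewrite row_mxKl row_mxKr cK// cK'.
  - move=> [y z] [/= xy xz]; apply: continuous_row_mx.
    + apply: (@continuous_comp _ _ _ fst (chart x.1)); first exact: cvg_fst.
      exact: ccont.
    + apply: (@continuous_comp _ _ _ snd (chart x.2)); first exact: cvg_snd.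
      exact: ccont'.
  - move=> [y z] [/= xy xz]; apply: continuous_pair_at.
    + apply: continuous_comp; first exact: continuous_lsubmx.
      by rewrite /= row_mxKl; exact: ucont.
    + apply: continuous_comp; first exact: continuous_rsubmx.
      by rewrite /= row_mxKr; exact: ucont'.
apply: Cinfty_local => _ [z [[/= x1 x2] [/= y1 y2]] <-].
apply: Cinfty_at_row_mx.
  apply: (Cinfty_at_comp (Cinfty_at_linear lsubmx _)
           (g := fun w => chart y.1 (unchart x.1 w))).
  rewrite /= row_mxKl; exact: Cinfty_at_transition.
apply: (Cinfty_at_comp (Cinfty_at_linear rsubmx _)
         (g := fun w => chart y.2 (unchart x.2 w))).
rewrite /= row_mxKr; exact: Cinfty_at_transition.
Qed.
End Charts.

Section SmoothAt.
Context {R : realType}.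
Implicit Types M N P : charted R.

(** By definition [tmap f x] is the differential of this map at [chart x x]. *)
Definition chart_rep N M (f : N -> M) (x : N) (w : 'rV[R]_(mdim N)) : 'rV[R]_(mdim M) :=
  chart (f x) (f (unchart x w)).

(** Continuity is what keeps [f] near [x] inside the domain of the chart at [f x]; the coordinate
    expression cannot detect this, its values off the domain being arbitrary. *)
Lemma smooth_atP N M (aN : has_atlas N) (aM : has_atlas M) (f : N -> M) x :
  smooth_at f x <->
  {for x, continuous f} /\ Cinfty_at (chart_rep f x) (chart x x).
Proof.
have Dx := chart_dom aN x; have Dfx := chart_dom aM (f x).
split=> [[U [oU Ux Ud fU cf]]|[cf [W [oW Wx] CW]]].
  have C : Cinfty_at (chart_rep f x) (chart x x).
    apply: near_Cinfty_at cf; apply: near_chart_image => //.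
    by apply: open_near oU Ux _.
  split=> //.
  apply: (@near_continuous _ _ (fun y => unchart (f x) (chart_rep f x (chart x y)))).
    apply: open_near oU Ux _ => y Uy.
    by rewrite /chart_rep !(chartK aN) ?(chartK aM)//; [exact: fU|exact: Ud].
  apply: (@continuous_comp _ _ _ (fun y => chart_rep f x (chart x y)) (unchart (f x))).
    apply: (@continuous_comp _ _ _ (chart x) (chart_rep f x)).
      exact: chart_continuous.
    exact: Cinfty_at_continuous C.
  rewrite /chart_rep (unchart_self aN); exact: unchart_continuous.
have near_x : \forall y \near x, [/\ cdom x y, W (chart x y) & cdom (f x) (f y)].
  apply: near_imp3 (near_cdom aN Dx)
    (near_chart aN Dx (open_nbhs_nbhs (conj oW Wx))) (cf _ (near_cdom aM Dfx)).
  by move=> y ? ? ?; split.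
have [U [oU Ux] UP] := near_open_nbhs near_x.
exists U; split=> //; [by move=> y /UP[]|by move=> y /UP[]|].
by move=> k; apply: Ck_sub (CW k) => _ [y /UP[_ Wy _] <-].
Qed.

Lemma smooth_at_continuous N M (aN : has_atlas N) (aM : has_atlas M) (f : N -> M) x :
  smooth_at f x -> {for x, continuous f}.
Proof. by move=> /(smooth_atP aN aM)[]. Qed.

Lemma smooth_at_rep N M (aN : has_atlas N) (aM : has_atlas M) (f : N -> M) x :
  smooth_at f x -> Cinfty_at (chart_rep f x) (chart x x).
Proof. by move=> /(smooth_atP aN aM)[]. Qed.

Lemma near_chart_rep_eq N M (aN : has_atlas N) (f g : N -> M) (x : N) :
  (\near x, f x = g x) ->
  \forall w \near chart x x, chart_rep f x w = chart_rep g x w.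
Proof.
move=> fg; apply: near_imp (near_unchart aN (chart_dom aN x) fg) => w.
by rewrite /chart_rep -(nbhs_singleton fg) => ->.
Qed.

Lemma smooth_at_near_eq N M (aN : has_atlas N) (aM : has_atlas M) (f g : N -> M) x :
  (\near x, f x = g x) -> smooth_at f x -> smooth_at g x.
Proof.
move=> fg /(smooth_atP aN aM)[cf Cf]; apply/(smooth_atP aN aM); split.
  exact: near_continuous fg cf.
exact: Cinfty_at_ext (near_chart_rep_eq aN fg) Cf.
Qed.

Lemma near_chart_rep_comp P N M (aP : has_atlas P) (aN : has_atlas N)
    (f : P -> N) (g : N -> M) x :
  {for x, continuous f} ->
  \forall w \near chart x x,
    chart_rep g (f x) (chart_rep f x w) = chart_rep (fun y => g (f y)) x w.
Proof.
move=> cf; have H := cf _ (near_cdom aN (chart_dom aN (f x))).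
apply: near_imp (near_unchart aP (chart_dom aP x) H) => w /= fw.
by rewrite /chart_rep (chartK aN).
Qed.

Lemma smooth_at_comp P N M (aP : has_atlas P) (aN : has_atlas N) (aM : has_atlas M)
    (f : P -> N) (g : N -> M) x :
  smooth_at f x -> smooth_at g (f x) -> smooth_at (fun y => g (f y)) x.
Proof.
move=> /(smooth_atP aP aN)[cf Cf] /(smooth_atP aN aM)[cg Cg].
apply/(smooth_atP aP aM); split; first exact: continuous_comp.
apply: Cinfty_at_ext (near_chart_rep_comp aP aN g cf) _.
by apply: Cinfty_at_comp => //; rewrite /chart_rep (unchart_self aP).
Qed.

Lemma tmap_comp P N M (aP : has_atlas P) (aN : has_atlas N) (aM : has_atlas M)
    (f : P -> N) (g : N -> M) x v :
  smooth_at f x -> smooth_at g (f x) ->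
  tmap (fun y => g (f y)) x v = tmap g (f x) (tmap f x v).
Proof.
move=> /(smooth_atP aP aN)[cf /Cinfty_at_differentiable df].
move=> /(smooth_at_rep aN aM)/Cinfty_at_differentiable dg.
have E : chart_rep f x (chart x x) = chart (f x) (f x).
  by rewrite /chart_rep (unchart_self aP).
have near_rep := near_chart_rep_comp aP aN g cf.
have e1 := near_eq_diff v near_rep (differentiable_funcomp E df dg).
exact: etrans (esym e1) (diff_funcomp v E df dg).
Qed.

Lemma smooth_at_cst N M (aN : has_atlas N) (aM : has_atlas M) (c : M) x :
  smooth_at (fun _ : N => c) x.
Proof.
apply/(smooth_atP aN aM); split; first exact: cst_continuous.
exact: Cinfty_at_cst.
Qed.

Lemma tmap_cst N M (c : M) (x : N) v : tmap (fun _ => c) x v = 0.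
Proof. by rewrite /tmap (diff_cst (chart c c)). Qed.

(** Serves the identity and the two projections: their coordinate expressions are linear only near
    the base point, where [chart] inverts [unchart]. *)
Lemma smooth_at_linear_rep N M (aN : has_atlas N) (aM : has_atlas M) (f : N -> M) x
    (L : {linear 'rV[R]_(mdim N) -> 'rV[R]_(mdim M)}) :
  {for x, continuous f} ->
  (\forall w \near chart x x, chart_rep f x w = L w) ->
  smooth_at f x /\ forall v, tmap f x v = L v.
Proof.
move=> cf fL.
have Lf : \forall w \near chart x x, L w = chart_rep f x w by apply: near_imp fL.
split.
  apply/(smooth_atP aN aM); split=> //.
  apply: Cinfty_at_ext Lf (Cinfty_at_linear _ _).
move=> v; have cL : continuous L by exact: linear_rV_continuous.
have e1 := near_eq_diff v Lf (linear_differentiable _ cL).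
have e2 := congr1 (@^~ v) (diff_lin (chart x x) cL).
exact: etrans (esym e1) e2.
Qed.

Lemma smooth_at_id_aux M (aM : has_atlas M) (x : M) :
  smooth_at (fun y : M => y) x /\ forall v, tmap (fun y : M => y) x v = v.
Proof.
apply: (@smooth_at_linear_rep _ _ aM aM _ _ idfun); first exact: cvg_id.
exact: near_unchartK (chart_dom aM x).
Qed.

Lemma smooth_at_id M (aM : has_atlas M) (x : M) : smooth_at (fun y : M => y) x.
Proof. exact: (smooth_at_id_aux aM x).1. Qed.

Lemma tmap_id M (aM : has_atlas M) (x : M) v : tmap (fun y : M => y) x v = v.
Proof. exact: (smooth_at_id_aux aM x).2. Qed.

Lemma smooth_at_fst_aux M N (aM : has_atlas M) (aN : has_atlas N) (x : prodm M N) :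
  smooth_at (fun y : prodm M N => y.1) x /\
  forall v, tmap (fun y : prodm M N => y.1) x v = lsubmx v.
Proof.
have aMN := prodm_atlas aM aN.
apply: (@smooth_at_linear_rep _ _ aMN aM _ _ lsubmx); first exact: cvg_fst.
apply: near_imp (near_unchartK aMN (chart_dom aMN x)) => w E.
by rewrite -[in RHS]E [RHS]row_mxKl.
Qed.

Lemma smooth_at_snd_aux M N (aM : has_atlas M) (aN : has_atlas N) (x : prodm M N) :
  smooth_at (fun y : prodm M N => y.2) x /\
  forall v, tmap (fun y : prodm M N => y.2) x v = rsubmx v.
Proof.
have aMN := prodm_atlas aM aN.
apply: (@smooth_at_linear_rep _ _ aMN aN _ _ rsubmx); first exact: cvg_snd.
apply: near_imp (near_unchartK aMN (chart_dom aMN x)) => w E.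
by rewrite -[in RHS]E [RHS]row_mxKr.
Qed.

Lemma smooth_at_fst M N (aM : has_atlas M) (aN : has_atlas N) (x : prodm M N) :
  smooth_at (fun y : prodm M N => y.1) x.
Proof. exact: (smooth_at_fst_aux aM aN x).1. Qed.

Lemma tmap_fst M N (aM : has_atlas M) (aN : has_atlas N) (x : prodm M N) v :
  tmap (fun y : prodm M N => y.1) x v = lsubmx v.
Proof. exact: (smooth_at_fst_aux aM aN x).2. Qed.

Lemma smooth_at_snd M N (aM : has_atlas M) (aN : has_atlas N) (x : prodm M N) :
  smooth_at (fun y : prodm M N => y.2) x.
Proof. exact: (smooth_at_snd_aux aM aN x).1. Qed.

Lemma tmap_snd M N (aM : has_atlas M) (aN : has_atlas N) (x : prodm M N) v :
  tmap (fun y : prodm M N => y.2) x v = rsubmx v.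
Proof. exact: (smooth_at_snd_aux aM aN x).2. Qed.

Lemma smooth_at_pair P M N (aP : has_atlas P) (aM : has_atlas M) (aN : has_atlas N)
    (f : P -> M) (g : P -> N) x :
  smooth_at f x -> smooth_at g x -> @smooth_at R P (prodm M N) (fun y => (f y, g y)) x.
Proof.
move=> /(smooth_atP aP aM)[cf Cf] /(smooth_atP aP aN)[cg Cg].
apply/(smooth_atP aP (prodm_atlas aM aN)); split; first exact: continuous_pair_at.
exact: Cinfty_at_row_mx.
Qed.

Lemma tmap_pair P M N (aP : has_atlas P) (aM : has_atlas M) (aN : has_atlas N)
    (f : P -> M) (g : P -> N) x v :
  smooth_at f x -> smooth_at g x ->
  @tmap R P (prodm M N) (fun y => (f y, g y)) x v = row_mx (tmap f x v) (tmap g x v).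
Proof.
move=> sf sg; have sfg := smooth_at_pair aP aM aN sf sg.
have aMN := prodm_atlas aM aN.
rewrite -[LHS](@hsubmxK _ 1 (mdim M) (mdim N)).
rewrite -(tmap_fst aM aN (f x, g x)) -(tmap_snd aM aN (f x, g x)).
congr row_mx.
  by rewrite -(tmap_comp aP aMN aM v sfg (smooth_at_fst aM aN _)).
by rewrite -(tmap_comp aP aMN aN v sfg (smooth_at_snd aM aN _)).
Qed.

Lemma tmap0 N M (f : N -> M) x : tmap f x 0 = 0.
Proof. exact: linear0. Qed.

Lemma tmapD N M (f : N -> M) x u v : tmap f x (u + v) = tmap f x u + tmap f x v.
Proof. exact: linearD. Qed.

Lemma tmapN N M (f : N -> M) x u : tmap f x (- u) = - tmap f x u.
Proof. exact: linearN. Qed.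

Lemma tmapZ N M (f : N -> M) x a u : tmap f x (a *: u) = a *: tmap f x u.
Proof. exact: linearZ. Qed.

Lemma tmap_sum N M (f : N -> M) x (J : Type) (r : seq J) (P : pred J) F :
  tmap f x (\sum_(i <- r | P i) F i) = \sum_(i <- r | P i) tmap f x (F i).
Proof. exact: linear_sum. Qed.

End SmoothAt.

(** * Smooth sections along a map *)

Section SmoothAlong.
Context {R : realType}.
Implicit Types M N P : charted R.

(** The chart of the target is global, so continuity of [W] is recovered from its coordinate
    expression. *)
Lemma smooth_at_euclidP N (aN : has_atlas N) r (W : N -> 'rV[R]_r) x :
  @smooth_at R N (euclid R r) W x <-> Cinfty_at (fun w => W (unchart x w)) (chart x x).
Proof.
have Dx := chart_dom aN x.
split=> [/(smooth_at_rep aN (euclid_atlas _))//|CW].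
apply/(smooth_atP aN (euclid_atlas r)); split=> //.
apply: (@near_continuous _ _ (fun y => W (unchart x (chart x y)))).
  by apply: near_imp (near_cdom aN Dx) => y xy; rewrite (chartK aN).
apply: (@continuous_comp _ _ _ (chart x) (fun w => W (unchart x w))).
  exact: chart_continuous.
exact: Cinfty_at_continuous CW.
Qed.

Definition tchart M (x y : M) (u : 'rV[R]_(mdim M)) : 'rV[R]_(mdim M) :=
  triv (tangent_bundle M) x y u.

(** Inverse of [tchart x y] when [y] lies in the domain of the chart at [x]: from coordinates in the
    fixed chart back to those in the chart at [y]. *)
Definition tunchart M (x y : M) (u : 'rV[R]_(mdim M)) : 'rV[R]_(mdim M) :=
  'd (fun w => chart y (unchart x w)) (chart x y) u.

Section OneManifold.
Variables (M : charted R) (aM : has_atlas M).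

(** The cocycle rule of the tangent bundle: the chain rule for changes of charts, whose composite
    equals the direct change near [chart x p]. *)
Lemma diff_transition (x y z p : M) u : cdom x p -> cdom y p -> cdom z p ->
  'd (fun w => chart z (unchart y w)) (chart y p)
    ('d (fun w => chart y (unchart x w)) (chart x p) u) =
  'd (fun w => chart z (unchart x w)) (chart x p) u.
Proof.
move=> xp yp zp.
have D1 := Cinfty_at_differentiable (Cinfty_at_transition aM xp yp).
have D2 := Cinfty_at_differentiable (Cinfty_at_transition aM yp zp).
have E : chart y (unchart x (chart x p)) = chart y p by rewrite (chartK aM).
have H : \forall w \near chart x p,
    chart z (unchart y (chart y (unchart x w))) = chart z (unchart x w).
  apply: near_imp (near_unchart aM xp (near_cdom aM yp)) => w yw.
  by rewrite (chartK aM yw).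
have e1 := near_eq_diff u H (differentiable_funcomp E D1 D2).
have e2 := diff_funcomp u E D1 D2.
exact (etrans (esym e2) e1).
Qed.

Lemma diff_transition_id (x p : M) u : cdom x p ->
  'd (fun w => chart x (unchart x w)) (chart x p) u = u.
Proof.
move=> xp.
have d := Cinfty_at_differentiable (Cinfty_at_transition aM xp xp).
have e1 := near_eq_diff (g := idfun) u (near_unchartK aM xp) d.
have ci : continuous (idfun : 'rV[R]_(mdim M) -> 'rV[R]_(mdim M)).
  by move=> y; exact: cvg_id.
exact (etrans e1 (congr1 (@^~ u) (@diff_lin _ _ _ idfun _ ci))).
Qed.

Lemma tchartK (x y : M) : cdom x y -> cancel (tchart x y) (tunchart x y).
Proof.
move=> xy u; have yy := chart_dom aM y.
by rewrite /tchart /tunchart /= diff_transition// diff_transition_id.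
Qed.

Lemma tunchartK (x y : M) : cdom x y -> cancel (tunchart x y) (tchart x y).
Proof.
move=> xy u; have yy := chart_dom aM y.
by rewrite /tchart /tunchart /= diff_transition// diff_transition_id.
Qed.

Lemma tchart_self (x : M) u : tchart x x u = u.
Proof. exact/diff_transition_id/chart_dom. Qed.

End OneManifold.

(** [tmap f y] is computed in charts that move with [y]. Read in the fixed charts at [x] and [f x],
    it becomes the differential of one function at a moving point, whose dependence on [y] can be
    controlled. *)
Lemma tchart_tmap N M (aN : has_atlas N) (aM : has_atlas M) (f : N -> M) x y u :
  smooth_at f x -> smooth_at f y -> cdom x y -> cdom (f x) (f y) ->
  differentiable (chart_rep f x) (chart x y) ->
  tchart (f x) (f y) (tmap f y u) = 'd (chart_rep f x) (chart x y) (tchart x y u).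
Proof.
move=> sx sy xy fxy d.
have yy := chart_dom aN y; have fyy := chart_dom aM (f y).
have cy := smooth_at_continuous aN aM sy.
have D1 := Cinfty_at_differentiable (smooth_at_rep aN aM sy).
have D2 := Cinfty_at_differentiable (Cinfty_at_transition aM fyy fxy).
have D3 := Cinfty_at_differentiable (Cinfty_at_transition aN yy xy).
have E1 : chart_rep f y (chart y y) = chart (f y) (f y).
  by rewrite /chart_rep (unchart_self aN).
have E2 : chart x (unchart y (chart y y)) = chart x y by rewrite (unchart_self aN).
have H : \forall w \near chart y y, chart (f x) (unchart (f y) (chart_rep f y w)) =
    chart_rep f x (chart x (unchart y w)).
  apply: near_imp2 (near_unchart aN yy (cy _ (near_cdom aM fyy)))
    (near_unchart aN yy (near_cdom aN xy)) => w /= fw xw.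
  by rewrite /chart_rep (chartK aM fw) (chartK aN xw).
have e1 := near_eq_diff u H (differentiable_funcomp E1 D1 D2).
have e2 := diff_funcomp u E1 D1 D2.
have e3 := diff_funcomp u E2 D3 d.
exact (etrans (esym e2) (etrans e1 e3)).
Qed.

(* [smooth_along] with the local extension replaced by a smooth coordinate
   expression in the trivialization at [f x]; the base map is not extended. *)
Definition smooth_section N M (E : vbundle M) (S : set N) (f : N -> M)
    (v : N -> 'rV[R]_(rank E)) : Prop :=
  forall x, S x -> exists2 W : N -> 'rV[R]_(rank E),
    @smooth_at R N (euclid R (rank E)) W x &
    \forall y \near x, S y -> triv E (f x) (f y) (v y) = W y.

Arguments smooth_section {N M} E S f v.

Lemma smooth_along_trivialP N M (aN : has_atlas N) (aM : has_atlas M) r (S : set N)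
    (f : N -> M) v : (forall x, S x -> smooth_at f x) ->
  smooth_along (trivial_bundle M r) S f v <->
  smooth_section (trivial_bundle M r) S f v.
Proof.
move=> sf; split=> sv x Sx.
  have [F [V [sF sV FV]]] := sv x Sx; exists V => //.
  by apply: near_imp FV => y Fy /Fy[_ ->].
have [W sW vW] := sv x Sx; exists f, W; split=> //; first exact: sf.
by apply: near_imp vW => y vW Sy; split=> //; rewrite -vW.
Qed.

(** For the converse, [f] extends itself, and the smooth coordinate expression [W] is carried back
    to a field of vectors by [tunchart]. *)
Lemma smooth_along_tangentP N M (aN : has_atlas N) (aM : has_atlas M) (S : set N)
    (f : N -> M) v : (forall x, S x -> smooth_at f x) ->
  smooth_along (tangent_bundle M) S f v <-> smooth_section (tangent_bundle M) S f v.
Proof.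
move=> sf; split=> sv x Sx.
  have [F [V [sF sV FV]]] := sv x Sx.
  exists (fun y => triv (tangent_bundle M) (f x) (F y) (V y)) => //.
  by apply: near_imp FV => y Fy /Fy[-> ->].
have [W sW vW] := sv x Sx.
have nfx := smooth_at_continuous aN aM (sf x Sx) (near_cdom_self aM (f x)).
exists f, (fun y => tunchart (f x) (f y) (W y)); split; first exact: sf.
  apply: smooth_at_near_eq sW; [exact: aN|exact: euclid_atlas|].
  by apply: near_imp nfx => y /= fy; rewrite [RHS](tunchartK aM fy).
apply: near_imp2 nfx vW => y /= fy vW Sy; split=> //.
by rewrite -(vW Sy) [LHS](tchartK aM fy).
Qed.

End SmoothAlong.

Arguments smooth_section {R N M} E S f v.

Section Sections.
Context {R : realType}.
Implicit Types M N P : charted R.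

Lemma smooth_section_eq N M (E : vbundle M) (S : set N) (f f' : N -> M) v v' :
  (forall x, S x -> f x = f' x) -> (forall x, S x -> v x = v' x) ->
  smooth_section E S f v -> smooth_section E S f' v'.
Proof.
move=> ff vv sv x Sx; have [W sW vW] := sv x Sx; exists W => //.
by apply: near_imp vW => y vW Sy; rewrite -!ff// -vv//; exact: vW.
Qed.

Lemma smooth_section_pullback N N' M (aN : has_atlas N) (aN' : has_atlas N')
    (E : vbundle M) (S : set N) (S' : set N') (h : N' -> N) (f : N -> M) v :
  (forall x, S' x -> smooth_at h x) -> (forall x, S' x -> S (h x)) ->
  smooth_section E S f v ->
  smooth_section E S' (fun y => f (h y)) (fun y => v (h y)).
Proof.
move=> sh hS sv x Sx; have [W sW vW] := sv _ (hS x Sx).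
exists (fun y => W (h y)).
  exact: (smooth_at_comp aN' aN (euclid_atlas _) (sh x Sx) sW).
apply: near_imp (smooth_at_continuous aN' aN (sh x Sx) vW) => y /= vWy Sy.
exact/vWy/hS.
Qed.

Lemma triv_tangentP M (x y : M) : linear (triv (tangent_bundle M) x y).
Proof. exact: linearP. Qed.

Lemma smooth_section_lin N M (aN : has_atlas N) (E : vbundle M) (S : set N)
    (f : N -> M) a u v :
  (forall x y, linear (triv E x y)) ->
  smooth_section E S f u -> smooth_section E S f v ->
  smooth_section E S f (fun x => a *: u x + v x).
Proof.
move=> lE su sv x Sx; have [U sU uU] := su x Sx; have [V sV vV] := sv x Sx.
exists (fun y => a *: U y + V y).
  move/(smooth_at_euclidP aN): sU => CU; move/(smooth_at_euclidP aN): sV => CV.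
  apply/(smooth_at_euclidP aN); apply: Cinfty_at_add CV.
  exact: (Cinfty_at_comp CU (Cinfty_at_linear ( *:%R a) _)).
by apply: near_imp2 uU vV => y uU vV Sy; rewrite lE uU// vV.
Qed.

Lemma smooth_section0 N M (aN : has_atlas N) (E : vbundle M) (S : set N)
    (f : N -> M) :
  (forall x y, linear (triv E x y)) -> smooth_section E S f (fun=> 0).
Proof.
move=> lE x Sx; exists (fun=> 0); first exact: smooth_at_cst (euclid_atlas _) _ _.
apply: (near_imp _ (near_cdom_self aN x)) => y _ Sy.
(* With scalar [-1], linearity reads [triv 0 = - triv 0 + triv 0]. *)
have := lE (f x) (f y) (-1) 0 0.
by rewrite !scaler0 addr0 scaleN1r addNr.
Qed.

(** In the fixed charts at [f x] and [phi (f x)] the new section is the differential of one smooth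
    map, applied to a smooth vector at a smooth base point: [tchart_tmap] gives this form and
    [Cinfty_at_diff] its smoothness. *)
Lemma smooth_section_tmap N M M' (aN : has_atlas N) (aM : has_atlas M)
    (aM' : has_atlas M') (S : set N) (f : N -> M) (phi : M -> M') v :
  (forall x, S x -> smooth_at f x) -> smooth phi ->
  smooth_section (tangent_bundle M) S f v ->
  smooth_section (tangent_bundle M') S (fun y => phi (f y))
    (fun y => tmap phi (f y) (v y)).
Proof.
move=> sf sphi sv x Sx; have [W sW vW] := sv x Sx.
have sfx := sf x Sx; have cf := smooth_at_continuous aN aM sfx.
have cphi := smooth_at_continuous aM aM' (sphi (f x)).
have Cphi := smooth_at_rep aM aM' (sphi (f x)).
exists (fun y => 'd (chart_rep phi (f x)) (chart (f x) (f y)) (W y)).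
  apply/(smooth_at_euclidP aN).
  move/(smooth_at_euclidP aN): sW => CW.
  apply: (Cinfty_at_diff (smooth_at_rep aN aM sfx) CW).
  by rewrite /chart_rep (unchart_self aN).
have H1 := cf _ (near_cdom_self aM (f x)).
have H2 := cf _ (cphi _ (near_cdom_self aM' (phi (f x)))).
have H3 := cf _ (near_chart aM (chart_dom aM (f x)) (Cinfty_at_near Cphi)).
have H12 : \forall y \near x, cdom (f x) (f y) /\ cdom (phi (f x)) (phi (f y)).
  by apply: near_imp2 H1 H2.
apply: near_imp3 H12 H3 vW => y [/= H H'] Cy vW Sy.
rewrite -(vW Sy); have d := Cinfty_at_differentiable Cy.
exact (tchart_tmap aM aM' _ (sphi _) (sphi _) H H' d).
Qed.

Lemma diff_linear_comp n m p (L : {linear 'rV[R]_m -> 'rV[R]_p})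
    (f : 'rV[R]_n -> 'rV[R]_m) x v :
  differentiable f x -> 'd (fun y => L (f y)) x v = L ('d f x v).
Proof.
move=> df; have cL := @linear_rV_continuous R m _ L.
have e := diff_funcomp v erefl df (linear_differentiable (f x) cL).
exact (etrans e (congr1 (@^~ ('d f x v)) (diff_lin (f x) cL))).
Qed.

Lemma diff_comp_linear n m p (L : {linear 'rV[R]_n -> 'rV[R]_m})
    (f : 'rV[R]_m -> 'rV[R]_p) x y v w :
  L x = y -> L v = w -> differentiable f y -> 'd (fun z => f (L z)) x v = 'd f y w.
Proof.
move=> Lx <- df; have cL := @linear_rV_continuous R n _ L.
have e := diff_funcomp v Lx (linear_differentiable x cL) df.
exact (etrans e (congr1 (fun w => 'd f y (w v)) (diff_lin x cL))).
Qed.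

Lemma diff_row_mx n m p (f : 'rV[R]_n -> 'rV[R]_m) (g : 'rV[R]_n -> 'rV[R]_p) x v :
  Cinfty_at f x -> Cinfty_at g x ->
  'd (fun y => row_mx (f y) (g y)) x v = row_mx ('d f x v) ('d g x v).
Proof.
move=> Cf Cg.
have d := Cinfty_at_differentiable (Cinfty_at_row_mx Cf Cg).
have el := diff_linear_comp lsubmx v d.
have er := diff_linear_comp rsubmx v d.
rewrite -[LHS](@hsubmxK _ 1 m p).
have El : (fun y => lsubmx (row_mx (f y) (g y))) = f.
  by apply/funext => y; rewrite row_mxKl.
have Er : (fun y => rsubmx (row_mx (f y) (g y))) = g.
  by apply/funext => y; rewrite row_mxKr.
rewrite El in el; rewrite Er in er.
exact (esym (f_equal2 row_mx el er)).
Qed.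

(** Changes of product charts act on the two blocks of coordinates separately, hence so do their
    differentials. *)
Lemma tchart_prod M N (aM : has_atlas M) (aN : has_atlas N) (x y : prodm M N) u v :
  cdom x y ->
  tchart x y (row_mx u v) = row_mx (tchart x.1 y.1 u) (tchart x.2 y.2 v).
Proof.
move=> [xy1 xy2].
have C1 := Cinfty_at_transition aM (chart_dom aM y.1) xy1.
have C2 := Cinfty_at_transition aN (chart_dom aN y.2) xy2.
have L1 : lsubmx (chart y y) = chart y.1 y.1 by rewrite row_mxKl.
have L2 : rsubmx (chart y y) = chart y.2 y.2 by rewrite row_mxKr.
have K1 : Cinfty_at (fun w => chart x.1 (unchart y.1 (lsubmx w))) (chart y y).
  apply: (Cinfty_at_comp (Cinfty_at_linear lsubmx _)
     (g := fun w => chart x.1 (unchart y.1 w))).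
  by rewrite /= row_mxKl.
have K2 : Cinfty_at (fun w => chart x.2 (unchart y.2 (rsubmx w))) (chart y y).
  apply: (Cinfty_at_comp (Cinfty_at_linear rsubmx _)
     (g := fun w => chart x.2 (unchart y.2 w))).
  by rewrite /= row_mxKr.
have e := diff_row_mx (row_mx u v) K1 K2.
have e1 := diff_comp_linear L1 (row_mxKl u v) (Cinfty_at_differentiable C1).
have e2 := diff_comp_linear L2 (row_mxKr u v) (Cinfty_at_differentiable C2).
exact (etrans e (f_equal2 row_mx e1 e2)).
Qed.

Lemma smooth_section_pair N M M' (aN : has_atlas N) (aM : has_atlas M)
    (aM' : has_atlas M') (S : set N) (f : N -> M) (f' : N -> M') u v :
  (forall x, S x -> smooth_at f x) -> (forall x, S x -> smooth_at f' x) ->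
  smooth_section (tangent_bundle M) S f u ->
  smooth_section (tangent_bundle M') S f' v ->
  smooth_section (tangent_bundle (prodm M M')) S
    (fun y => (f y, f' y) : prodm M M') (fun y => row_mx (u y) (v y)).
Proof.
move=> sf sf' su sv x Sx; have [U sU uU] := su x Sx; have [V sV vV] := sv x Sx.
exists (fun y => row_mx (U y) (V y)).
  move/(smooth_at_euclidP aN): sU => CU; move/(smooth_at_euclidP aN): sV => CV.
  by apply/(smooth_at_euclidP aN); exact: Cinfty_at_row_mx.
have H1 := smooth_at_continuous aN aM (sf x Sx) (near_cdom_self aM (f x)).
have H2 := smooth_at_continuous aN aM' (sf' x Sx) (near_cdom_self aM' (f' x)).
have H12 : \forall y \near x, cdom (f x) (f y) /\ cdom (f' x) (f' y).
  by apply: near_imp2 H1 H2.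
apply: near_imp3 H12 uU vV => y H uU vV Sy; rewrite -(uU Sy) -(vV Sy).
exact: (@tchart_prod _ _ aM aM' (f x, f' x) (f y, f' y)).
Qed.

(** Over a constant base point the trivialization is the identity. This lets cochains with values in
    the trivial bundle g_M be handled as sections of T G along the constant map at the unit. *)
Lemma smooth_section_cst N M (aN : has_atlas N) (aM : has_atlas M) (S : set N)
    (c : M) (P : charted R) (f : N -> P) v :
  smooth_section (tangent_bundle M) S (fun=> c) v <->
  smooth_section (trivial_bundle P (mdim M)) S f v.
Proof.
split=> sv x Sx; have [W sW vW] := sv x Sx; exists W => //;
  apply: near_imp vW => y vW Sy; rewrite -(vW Sy).
  exact (esym (tchart_self aM c (v y))).
exact (tchart_self aM c (v y)).
Qed.

End Sections.

(** * Translations in a Lie group and Lie group actions *)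

Section TmapOn.
Context {R : realType}.
Implicit Types M N P : charted R.

(** A directional derivative samples only a line, so [f] and [g] may differ off it; an extension is
    compared with the original map in this way. *)
Lemma derive_near_line (V W : normedModType R) (f g : V -> W) x v :
  (\forall h \near (0 : R), f (h *: v + x) = g (h *: v + x)) -> 'D_v f x = 'D_v g x.
Proof.
move=> fg; have fgx : f x = g x.
  by have := nbhs_singleton fg; rewrite scale0r add0r.
have H : \forall h \near (0 : R), h^-1 *: ((f \o shift x) (h *: v) - f x) =
    h^-1 *: ((g \o shift x) (h *: v) - g x).
  by apply: near_imp fg => h /= ->; rewrite fgx.
rewrite /derive; congr (lim _); rewrite eqEsubset.
split; apply/near_eq_cvg/cvg_within; first by apply: near_imp H => h ->.
by apply: near_imp H => h ->.
Qed.

(* Any extension of [f] agrees with [f] along the curve [t |-> phi (p + t u)],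
   which stays in [S]; so it has the same derivative along [tmap phi p u]. *)
Lemma tmap_on_curve P N M (aP : has_atlas P) (aN : has_atlas N) (aM : has_atlas M)
    (S : set N) (f : N -> M) (phi : P -> N) p u :
  smooth_at phi p -> smooth_at f (phi p) ->
  (\forall t \near (0 : R), S (phi (unchart p (t *: u + chart p p)))) ->
  tmap_on S f (phi p) (tmap phi p u) = tmap f (phi p) (tmap phi p u).
Proof.
move=> sphi sf Sphi.
have Sp : S (phi p).
  by have := nbhs_singleton Sphi; rewrite scale0r add0r (unchart_self aP).
have line : {for (0 : R), continuous (fun t : R => phi (unchart p (t *: u + chart p p)))}.
  apply: (@continuous_comp _ _ _ (fun t : R => unchart p (t *: u + chart p p)) phi).
    apply: (@continuous_comp _ _ _ (fun t : R => t *: u + chart p p) (unchart p)).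
      apply: continuousD; last exact: cst_continuous.
      exact: scalel_continuous.
    by rewrite /= scale0r add0r; exact: (unchart_continuous aP (chart_dom aP p)).
  rewrite scale0r add0r (unchart_self aP).
  exact: smooth_at_continuous sphi.
have key F : smooth_at F (phi p) -> (\forall y \near phi p, S y -> F y = f y) ->
    tmap F (phi p) (tmap phi p u) = tmap f (phi p) (tmap phi p u).
  move=> sF Ff.
  rewrite -(tmap_comp aP aN aM u sphi sF) -(tmap_comp aP aN aM u sphi sf).
  have dF := Cinfty_at_differentiable (smooth_at_rep aP aM (smooth_at_comp aP aN aM sphi sF)).
  have df := Cinfty_at_differentiable (smooth_at_rep aP aM (smooth_at_comp aP aN aM sphi sf)).
  have e1 := deriveE u dF; have e2 := deriveE u df.
  refine (etrans (esym e1) (etrans _ e2)); apply: derive_near_line.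
  have Ffp := nbhs_singleton Ff Sp.
  have L : \forall t \near (0 : R), S (phi (unchart p (t *: u + chart p p))) ->
      F (phi (unchart p (t *: u + chart p p))) = f (phi (unchart p (t *: u + chart p p))).
    move: line; rewrite /prop_for /continuous_at scale0r add0r (unchart_self aP).
    by move=> line; exact: line _ Ff.
  apply: near_imp2 Sphi L => t St /(_ St) e.
  by rewrite /chart_rep e Ffp.
(* The set of candidate values contains the one given by [f], its own extension, and by [key] no
   other. *)
rewrite /tmap_on; apply: xget_subset1.
  exists f; split=> //; by apply: (near_imp _ (near_cdom_self aN (phi p))).
move=> w w' [F [sF Ff ->]] [F' [sF' Ff' ->]].
by rewrite (key F sF Ff) (key F' sF' Ff').
Qed.

Lemma tmap_partial P N M (aP : has_atlas P) (aN : has_atlas N) (aM : has_atlas M)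
    (f : prodm P N -> M) x y u v :
  smooth_at f ((x, y) : prodm P N) ->
  tmap f ((x, y) : prodm P N) (row_mx u v) =
  tmap (fun z => f (z, y)) x u + tmap (fun z => f (x, z)) y v.
Proof.
move=> sf; have aPN := prodm_atlas aP aN.
have -> : row_mx u v = row_mx u 0 + row_mx 0 v by rewrite add_row_mx addr0 add0r.
rewrite tmapD; congr (_ + _).
  have s1 := smooth_at_id aP x; have s2 := smooth_at_cst aP aN y x.
  have sp := smooth_at_pair aP aP aN s1 s2.
  rewrite (tmap_comp aP aPN aM u sp sf) (tmap_pair aP aP aN u s1 s2).
  by rewrite (tmap_id aP) tmap_cst.
have s1 := smooth_at_cst aN aP x y; have s2 := smooth_at_id aN y.
have sp := smooth_at_pair aN aP aN s1 s2.
rewrite (tmap_comp aN aPN aM v sp sf) (tmap_pair aN aP aN v s1 s2).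
by rewrite (tmap_id aN) tmap_cst.
Qed.

Lemma eq_tmap N M (f g : N -> M) x v : f =1 g -> tmap f x v = tmap g x v.
Proof. by move=> /funext ->. Qed.

End TmapOn.

(** * Differential calculus of translations and inversion in a Lie group *)

Section Group.
Context {R : realType} (G : lie_group R).
Local Notation aG := (manifold_atlas G).
Local Notation e := (lone G).

Lemma lmulgV (g : G) : lmul g (linv g) = e.
Proof.
rewrite -[LHS]lmul1g -{1}(lmulVg (linv g)) -lmulA [X in lmul _ X]lmulA.
by rewrite lmulVg lmul1g lmulVg.
Qed.

Lemma lmulg1 (g : G) : lmul g e = g.
Proof. by rewrite -(lmulVg g) lmulA lmulgV lmul1g. Qed.

Lemma lmul_inj (k g h : G) : lmul k g = lmul k h -> g = h.
Proof.
by move=> /(congr1 (lmul (linv k))); rewrite !lmulA lmulVg !lmul1g.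
Qed.

Lemma linv1 : linv e = e.
Proof. by rewrite -[LHS]lmulg1 lmulVg. Qed.

Lemma linvM (g h : G) : linv (lmul g h) = lmul (linv h) (linv g).
Proof.
apply: (@lmul_inj (lmul g h)).
by rewrite lmulgV -lmulA (lmulA h) lmulgV lmul1g lmulgV.
Qed.

(** The translating element [k] comes first and the base point [h] second: [mulR k h] goes from T_h
    G to T_(hk) G, and [mulL k h] from T_h G to T_(kh) G. *)
Definition mulR (k h : G) := tmap (fun h' : G => lmul h' k : G) h.
Definition mulL (k h : G) := tmap (fun h' : G => lmul k h' : G) h.

Lemma smooth_lmul N (aN : has_atlas N) (f g : N -> G) x :
  smooth_at f x -> smooth_at g x -> smooth_at (fun y => lmul (f y) (g y) : G) x.
Proof.
move=> sf sg; have sp := smooth_at_pair aN aG aG sf sg.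
exact: (smooth_at_comp aN (prodm_atlas aG aG) aG sp (lmul_smooth (f x, g x))).
Qed.

Lemma smooth_linv N (aN : has_atlas N) (f : N -> G) x :
  smooth_at f x -> smooth_at (fun y => linv (f y) : G) x.
Proof. move=> sf; exact: (smooth_at_comp aN aG aG sf (linv_smooth (f x))). Qed.

Lemma smooth_mulR (k h : G) : smooth_at (fun h' : G => lmul h' k : G) h.
Proof. exact (smooth_lmul aG (smooth_at_id aG h) (smooth_at_cst aG aG k h)). Qed.

Lemma smooth_mulL (k h : G) : smooth_at (fun h' : G => lmul k h' : G) h.
Proof. exact (smooth_lmul aG (smooth_at_cst aG aG k h) (smooth_at_id aG h)). Qed.

Lemma tmap_lmul N (aN : has_atlas N) (f g : N -> G) x v :
  smooth_at f x -> smooth_at g x ->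
  tmap (fun y => lmul (f y) (g y) : G) x v =
  mulR (g x) (f x) (tmap f x v) + mulL (f x) (g x) (tmap g x v).
Proof.
move=> sf sg; have sp := smooth_at_pair aN aG aG sf sg.
have sm := lmul_smooth (f x, g x).
rewrite (tmap_comp aN (prodm_atlas aG aG) aG v sp sm).
by rewrite (tmap_pair aN aG aG v sf sg) (tmap_partial aG aG aG _ _ sm).
Qed.

Lemma mulR_mulR (k k' h : G) u :
  mulR k' (lmul h k) (mulR k h u) = mulR (lmul k k') h u.
Proof.
rewrite /mulR -(tmap_comp aG aG aG u (smooth_mulR k h) (smooth_mulR k' _)).
by apply: eq_tmap => h'; rewrite lmulA.
Qed.

Lemma mulL_mulL (k k' h : G) u :
  mulL k' (lmul k h) (mulL k h u) = mulL (lmul k' k) h u.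
Proof.
rewrite /mulL -(tmap_comp aG aG aG u (smooth_mulL k h) (smooth_mulL k' _)).
by apply: eq_tmap => h'; rewrite lmulA.
Qed.

Lemma mulR1 (h : G) u : mulR e h u = u.
Proof.
rewrite /mulR -[RHS](tmap_id aG h); apply: eq_tmap => h'.
by rewrite lmulg1.
Qed.

Lemma mulL1 (h : G) u : mulL e h u = u.
Proof.
rewrite /mulL -[RHS](tmap_id aG h); apply: eq_tmap => h'.
by rewrite lmul1g.
Qed.

(** Differentiating y y^-1 = e at the unit gives v + di(v) = 0. *)
Lemma tmap_linv1 v : tmap (@linv R G : G -> G) e v = - v.
Proof.
have sl : smooth_at (@linv R G : G -> G) e by exact: linv_smooth.
have := tmap_lmul aG v (smooth_at_id aG e) sl.
rewrite (@eq_tmap _ _ _ _ (fun=> e)) ?tmap_cst; last by move=> y; exact: lmulgV.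
rewrite linv1 mulR1 mulL1 (tmap_id aG) => /eqP.
by rewrite eq_sym addrC addr_eq0 => /eqP.
Qed.

(** Differentiate (y h)^-1 = h^-1 y^-1 at y = e. *)
Lemma tmap_linv (h : G) v :
  tmap (@linv R G : G -> G) h (mulR h e v) = - mulL (linv h) e v.
Proof.
have sl g : smooth_at (@linv R G : G -> G) g by exact: linv_smooth.
have := tmap_comp aG aG aG v (smooth_mulR h e) (sl _).
rewrite lmul1g => <-.
rewrite (@eq_tmap _ _ _ _ (fun y => lmul (linv h) (linv y))); last first.
  by move=> y; exact: linvM.
have := tmap_comp aG aG aG v (sl e) (smooth_mulL (linv h) _).
by move=> ->; rewrite tmap_linv1 linv1 tmapN.
Qed.

Lemma Ad_mul (g : G) v : Ad g v = mulR (linv g) g (mulL g e v).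
Proof.
have := tmap_comp aG aG aG v (smooth_mulL g e) (smooth_mulR (linv g) _).
by rewrite lmulg1 => H; exact H.
Qed.

End Group.

Lemma rsubmx_line (R : realType) m n (t : R) (u x : 'rV[R]_m) (v y : 'rV[R]_n) :
  rsubmx (t *: row_mx u v + row_mx x y) = t *: v + y.
Proof. by rewrite scale_row_mx add_row_mx row_mxKr. Qed.

Lemma lsubmx_line (R : realType) m n (t : R) (u x : 'rV[R]_m) (v y : 'rV[R]_n) :
  lsubmx (t *: row_mx u v + row_mx x y) = t *: u + x.
Proof. by rewrite scale_row_mx add_row_mx row_mxKl. Qed.

(** * Structure maps of the action groupoid and their differentials *)

Section Action.
Context {R : realType} {G : lie_group R} {M : manifold R} (a : lie_action G M).
Local Notation aG := (manifold_atlas G).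
Local Notation aM := (manifold_atlas M).
Local Notation e := (lone G).
Local Notation H := (action_groupoid a).

Lemma arr_atlas : has_atlas (prodm G M).
Proof. exact (prodm_atlas aG aM). Qed.
Local Notation aA := arr_atlas.

Definition actL (x : M) (g : G) := tmap (fun h : G => a h x : M) g.
Definition actR (g : G) (x : M) := tmap (a g : M -> M) x.

Lemma smooth_act N (aN : has_atlas N) (f : N -> G) (g : N -> M) x :
  smooth_at f x -> smooth_at g x -> smooth_at (fun y => a (f y) (g y) : M) x.
Proof.
move=> sf sg; have sp := smooth_at_pair aN aG aM sf sg.
exact: (smooth_at_comp aN aA aM sp (lact_smooth a (f x, g x))).
Qed.

Lemma tmap_act N (aN : has_atlas N) (f : N -> G) (g : N -> M) x v :
  smooth_at f x -> smooth_at g x ->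
  tmap (fun y => a (f y) (g y) : M) x v =
  actL (g x) (f x) (tmap f x v) + actR (f x) (g x) (tmap g x v).
Proof.
move=> sf sg; have sp := smooth_at_pair aN aG aM sf sg.
have sm := lact_smooth a (f x, g x).
rewrite (tmap_comp aN aA aM v sp sm).
by rewrite (tmap_pair aN aG aM v sf sg) (tmap_partial aG aM aM _ _ sm).
Qed.

Lemma smooth_actL (x : M) (g : G) : smooth_at (fun h : G => a h x : M) g.
Proof. exact (smooth_act aG (smooth_at_id aG g) (smooth_at_cst aG aM x g)). Qed.

Lemma smooth_actR (g : G) (x : M) : smooth_at (a g : M -> M) x.
Proof. exact (smooth_act aM (smooth_at_cst aM aG g x) (smooth_at_id aM x)). Qed.

Lemma mulR_mulR1 (k k' : G) u : mulR k' k (mulR k e u) = mulR (lmul k k') e u.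
Proof. by have := mulR_mulR k k' e u; rewrite lmul1g. Qed.

Lemma mulL_mulL1 (k k' : G) u : mulL k' k (mulL k e u) = mulL (lmul k' k) e u.
Proof. by have := mulL_mulL k k' e u; rewrite lmulg1. Qed.

(** Conjugation by g followed by right translation by g is left translation by g. Every left
    translation produced by inversion is absorbed into the right trivialization through this
    identity. *)
Lemma mulR_Ad (g : G) v : mulR g e (Ad g v) = mulL g e v.
Proof.
rewrite Ad_mul; have := mulR_mulR (linv g) g g (mulL g e v).
by rewrite lmulgV lmulVg mulR1.
Qed.

Lemma mulRK (g : G) u : mulR (linv g) g (mulR g e u) = u.
Proof. by rewrite mulR_mulR1 lmulgV mulR1. Qed.

Lemma mulRVK (g : G) u : mulR g e (mulR (linv g) g u) = u.
Proof. by have := mulR_mulR (linv g) g g u; rewrite lmulgV lmulVg mulR1. Qed.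

Lemma inf_actionE (x : M) v : inf_action a x v = actL x e v.
Proof.
have s1 : smooth_at (fun y : prodm G M => y.1) ((e, x) : prodm G M).
  exact: smooth_at_fst aG aM _.
have s2 : smooth_at (fun y : prodm G M => y.2) ((e, x) : prodm G M).
  exact: smooth_at_snd aG aM _.
have := tmap_act aA (row_mx v 0) s1 s2.
rewrite (tmap_fst aG aM) (tmap_snd aG aM) row_mxKl row_mxKr => E.
refine (etrans E _).
by rewrite /actR tmap0 addr0.
Qed.

(** Differentiate (h g) x = h (g x) at h = e: in the right trivialization the infinitesimal action
    is taken at the target. *)
Lemma actL_mulR (x : M) (g : G) v : actL x g (mulR g e v) = inf_action a (a g x) v.
Proof.
rewrite inf_actionE /actL.
have := tmap_comp aG aG aM v (smooth_mulR g e) (smooth_actL x _).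
by rewrite lmul1g => <-; apply: eq_tmap => h; rewrite lactM.
Qed.

(** Differentiate g (h x) = (g h g^-1) (g x) at h = e. This equivariance makes rho a morphism of
    representations, hence a cochain map. *)
Lemma inf_action_equivariant (g : G) (x : M) v :
  actR g x (inf_action a x v) = inf_action a (a g x) (Ad g v).
Proof.
rewrite !inf_actionE /actL /actR.
have := tmap_comp aG aM aM v (smooth_actL x e) (smooth_actR g _).
rewrite lact1 => <-.
have sAd : smooth_at (fun h : G => lmul (lmul g h) (linv g) : G) e.
  exact (smooth_at_comp aG aG aG (smooth_mulL g e) (smooth_mulR (linv g) _)).
have := tmap_comp aG aG aM v sAd (smooth_actL (a g x) _).
rewrite lmulg1 lmulgV => <-; apply: eq_tmap => h.
by rewrite -!lactM -lmulA lmulVg lmulg1.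
Qed.

(** The vector has no M-component, so the straight line it spans in the chart stays in the source
    fibre and serves as the curve for [tmap_on_curve]. *)
Lemma right_inv_action (al : M -> 'rV[R]_(mdim G + mdim M)) (g : prodm G M) v :
  al (a g.1 g.2) = row_mx v 0 ->
  @right_inv R H al g = row_mx (mulR g.1 e v) 0.
Proof.
move=> alE; rewrite /right_inv /= alE.
set p : prodm G M := (e, a g.1 g.2).
have sid := smooth_at_id aA p.
have s1 : smooth_at (fun h : prodm G M => lmul h.1 g.1 : G) p.
  exact (smooth_lmul aA (smooth_at_fst aG aM p) (smooth_at_cst aA aG g.1 p)).
have s2 : smooth_at (fun h : prodm G M => g.2) p by exact: smooth_at_cst aA aM _ _.
have sf : smooth_at (fun h : prodm G M => (lmul h.1 g.1, g.2) : prodm G M) p.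
  exact (smooth_at_pair aA aG aM s1 s2).
have Sp : \forall t \near (0 : R),
    [set h : prodm G M | h.2 = a g.1 g.2]
      (unchart p (t *: (row_mx v 0 : 'rV[R]_(mdim G + mdim M)) + chart p p)).
  apply: filterE => t /=.
  rewrite rsubmx_line scaler0 add0r.
  exact: unchart_self aM _.
have := tmap_on_curve aA aA aA sid sf Sp.
rewrite (tmap_id aA) => ->.
rewrite (tmap_pair aA aG aM _ s1 s2) tmap_cst.
rewrite (tmap_lmul aA _ (smooth_at_fst aG aM p) (smooth_at_cst aA aG g.1 p)).
by rewrite tmap_cst (tmap_fst aG aM) row_mxKl /mulL tmap0 addr0.
Qed.

Lemma left_inv_action (al : M -> 'rV[R]_(mdim G + mdim M)) (g : prodm G M) v :
  al g.2 = row_mx v 0 ->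
  @left_inv R H al g = row_mx (- mulL g.1 e v) (inf_action a g.2 v).
Proof.
move=> alE; rewrite /left_inv /= alE.
set p : prodm G M := (e, g.2).
have sf := smooth_at_fst aG aM p; have ss := smooth_at_snd aG aM p.
have sfV : smooth_at (fun h : prodm G M => linv h.1 : G) p.
  exact (smooth_linv aA sf).
have sa : smooth_at (fun h : prodm G M => a h.1 h.2 : M) p.
  exact (smooth_act aA sf ss).
have si : smooth_at (fun h : prodm G M => (linv h.1, a h.1 h.2) : prodm G M) p.
  exact (smooth_at_pair aA aG aM sfV sa).
set q : prodm G M := (linv e, a e g.2).
have sm1 : smooth_at (fun h : prodm G M => lmul g.1 h.1 : G) q.
  exact (smooth_lmul aA (smooth_at_cst aA aG g.1 q) (smooth_at_fst aG aM q)).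
have sm : smooth_at (fun h : prodm G M => (lmul g.1 h.1, h.2) : prodm G M) q.
  exact (smooth_at_pair aA aG aM sm1 (smooth_at_snd aG aM q)).
(* The line at the unit arrow has constant source [g.2]; its arrows are inverted, so the resulting
   curve has constant target [g.2]. *)
have Sp : \forall t \near (0 : R),
    [set h : prodm G M | a h.1 h.2 = g.2]
      ((fun h : prodm G M => (linv h.1, a h.1 h.2) : prodm G M)
       (unchart p (t *: (row_mx v 0 : 'rV[R]_(mdim G + mdim M)) + chart p p))).
  apply: filterE => t /=.
  rewrite -lactM lmulVg lact1.
  rewrite rsubmx_line scaler0 add0r.
  exact: unchart_self aM _.
have := tmap_on_curve aA aA aA si sm Sp.
move=> ->.
rewrite (tmap_pair aA aG aM _ sm1 (smooth_at_snd aG aM q)) (tmap_snd aG aM).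
rewrite (tmap_lmul aA _ (smooth_at_cst aA aG g.1 q) (smooth_at_fst aG aM q)).
rewrite tmap_cst (tmap_fst aG aM) /mulR tmap0 add0r.
rewrite (tmap_pair aA aG aM _ sfV sa) row_mxKl row_mxKr.
congr row_mx.
  have := tmap_comp aA aG aG (row_mx v 0) sf (linv_smooth _).
  rewrite /= => ->; rewrite (tmap_fst aG aM) row_mxKl.
  by rewrite tmap_linv1 /mulL tmapN linv1.
Qed.

(** The common component [W] keeps the straight line inside the pairs of arrows with equal source,
    and (g h^-1, h x) is smooth on all pairs. *)
Lemma dmbar_action (g h : G) (x : M) V V' W :
  @dmbar R H (g, x) (h, x) (row_mx V W) (row_mx V' W) =
  row_mx (mulR (linv h) g V + mulL g (linv h) (tmap (@linv R G : G -> G) h V'))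
         (actL x h V' + actR h x W).
Proof.
rewrite /dmbar.
have aAA := prodm_atlas aA aA.
set p : prodm (prodm G M) (prodm G M) := ((g, x), (h, x)).
set u := row_mx (row_mx V W) (row_mx V' W).
have sid := smooth_at_id aAA p.
have s1 := smooth_at_fst aA aA p; have s2 := smooth_at_snd aA aA p.
have s11 : smooth_at (fun r : prodm (prodm G M) (prodm G M) => r.1.1) p.
  exact (smooth_at_comp aAA aA aG s1 (smooth_at_fst aG aM _)).
have s21 : smooth_at (fun r : prodm (prodm G M) (prodm G M) => r.2.1) p.
  exact (smooth_at_comp aAA aA aG s2 (smooth_at_fst aG aM _)).
have s22 : smooth_at (fun r : prodm (prodm G M) (prodm G M) => r.2.2) p.
  exact (smooth_at_comp aAA aA aM s2 (smooth_at_snd aG aM _)).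
have sV := smooth_linv aAA s21.
have sm := smooth_lmul aAA s11 sV.
have sa := smooth_act aAA s21 s22.
have sf := smooth_at_pair aAA aG aM sm sa.
have t11 : tmap (fun r : prodm (prodm G M) (prodm G M) => r.1.1) p u = V.
  have := tmap_comp aAA aA aG u s1 (smooth_at_fst aG aM _).
  by move=> ->; rewrite (tmap_fst aA aA) (tmap_fst aG aM) !row_mxKl.
have t21 : tmap (fun r : prodm (prodm G M) (prodm G M) => r.2.1) p u = V'.
  have := tmap_comp aAA aA aG u s2 (smooth_at_fst aG aM _).
  by move=> ->; rewrite (tmap_snd aA aA) (tmap_fst aG aM) row_mxKr row_mxKl.
have t22 : tmap (fun r : prodm (prodm G M) (prodm G M) => r.2.2) p u = W.
  have := tmap_comp aAA aA aM u s2 (smooth_at_snd aG aM _).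
  by move=> ->; rewrite (tmap_snd aA aA) (tmap_snd aG aM) !row_mxKr.
have Sp : \forall t \near (0 : R),
    [set r : prodm (prodm G M) (prodm G M) | r.1.2 = r.2.2]
      (unchart p (t *: u + chart p p)).
  apply: filterE => t /=.
  by rewrite /u lsubmx_line !rsubmx_line.
have := tmap_on_curve aAA aAA aA sid sf Sp.
rewrite (tmap_id aAA) => ->.
rewrite (tmap_pair aAA aG aM _ sm sa) (tmap_lmul aAA _ s11 sV) (tmap_act aAA _ s21 s22).
rewrite t11 t21 t22.
have := tmap_comp aAA aG aG u s21 (linv_smooth _).
by rewrite t21 => ->.
Qed.

(** Inversion turns R_h v' into - L_(h^-1) v', and left translation by gh turns this into - L_g v' =
    - R_g (Ad_g v'). Both parts of the group component are then right translates by g. *)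
Lemma dmbar_trivialized (g h : G) (x : M) v v' W :
  @dmbar R H (lmul g h, x) (h, x)
    (row_mx (mulR (lmul g h) e v) W) (row_mx (mulR h e v') W) =
  row_mx (mulR g e (v - Ad g v')) (inf_action a (a h x) v' + actR h x W).
Proof.
rewrite dmbar_action mulR_mulR1 actL_mulR tmap_linv /mulL tmapN -/(mulL _ _ _).
rewrite mulL_mulL1 -lmulA lmulgV lmulg1.
by rewrite /mulR tmapD tmapN -/(mulR g e (Ad g v')) mulR_Ad.
Qed.

End Action.

(** * The long exact sequence of a cone *)

Section CohomologyMaps.
Variable R : realType.

(** Linearity of the differential is asked on admissible cochains and modulo [nul]: for the
    deformation complex it is derived from the component formula, which holds there. *)
Record linear_complex (C : complex R) : Prop := LinearComplex {
  adm0 : forall k, adm (0 : cc C k);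
  nul0 : forall k, nul (0 : cc C k);
  adm_lin : forall k a (u v : cc C k), adm u -> adm v -> adm (a *: u + v);
  nul_lin : forall k a (u v : cc C k), nul u -> nul v -> nul (a *: u + v);
  cd_lin : forall k a (u v : cc C k), adm u -> adm v ->
    nul (cd (a *: u + v) - (a *: cd u + cd v)) }.

Section OneComplex.
Variables (C : complex R) (lC : linear_complex C).

Lemma nulD k (u v : cc C k) : nul u -> nul v -> nul (u + v).
Proof. by move=> nu nv; rewrite -[u]scale1r; exact: nul_lin. Qed.

Lemma nulN k (u : cc C k) : nul u -> nul (- u).
Proof.
by move=> nu; rewrite -[- u]addr0 -scaleN1r; apply: nul_lin => //; exact: nul0.
Qed.

Lemma nul_cd0 k : nul (cd (0 : cc C k)).
Proof.
have := cd_lin lC (-1) (adm0 lC k) (adm0 lC k).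
by rewrite scaleN1r addNr scaleN1r addNr subr0.
Qed.

Lemma cocycle0 k : cocycle (0 : cc C k).
Proof. split; [exact: adm0|exact: nul_cd0]. Qed.

Lemma coboundary_nul k (u : cc C k) : nul u -> coboundary u.
Proof.
case: k u => [//|k] u nu /=; exists 0; first exact: adm0.
by apply: nulD => //; apply: nulN; exact: nul_cd0.
Qed.

Lemma coboundary_lin k a (u v : cc C k) :
  coboundary u -> coboundary v -> coboundary (a *: u + v).
Proof.
case: k u v => [|k] u v /=; first exact: nul_lin.
move=> [b Ab ub] [b' Ab' vb]; exists (a *: b + b'); first exact: adm_lin.
rewrite (_ : _ - _ = (a *: (u - cd b) + (v - cd b'))
    - (cd (a *: b + b') - (a *: cd b + cd b'))).
  by apply: nulD; [exact: nul_lin|apply: nulN; exact: cd_lin].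
by rewrite scalerBr opprB addrA; congr (_ - _); rewrite [RHS]addrACA !subrK.
Qed.

Lemma coboundaryD k (u v : cc C k) : coboundary u -> coboundary v -> coboundary (u + v).
Proof. by move=> cu cv; rewrite -[u]scale1r; exact: coboundary_lin. Qed.

Lemma coboundaryN k (u : cc C k) : coboundary u -> coboundary (- u).
Proof.
move=> cu; rewrite -[- u]addr0 -scaleN1r; apply: coboundary_lin => //.
exact/coboundary_nul/nul0.
Qed.

Lemma coboundaryC k (u v : cc C k) : coboundary (u - v) -> coboundary (v - u).
Proof. by move/coboundaryN; rewrite opprB. Qed.

Lemma cclass_eq k (u v : cc C k) : coboundary (u - v) -> cclass u = cclass v.
Proof.
move=> uv; apply/seteqP; split=> z [cz bz]; split=> //.
  by rewrite -(subrKA u); exact: coboundaryD.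
by rewrite -(subrKA v); apply: coboundaryD => //; exact: coboundaryC.
Qed.

Definition coh_of k (z : cc C k) (cz : cocycle z) : coh C k :=
  exist _ (cclass z) (ex_intro2 _ _ z cz erefl).

Lemma mem_coh_of k (z : cc C k) (cz : cocycle z) : mem_coh (coh_of cz) z.
Proof. split=> //; rewrite subrr; exact/coboundary_nul/nul0. Qed.

Lemma mem_coh_ex k (x : coh C k) : exists z, mem_coh x z.
Proof.
case: x => x [z cz xz]; exists z; rewrite /mem_coh /= xz.
exact: (mem_coh_of cz).
Qed.

Lemma mem_coh_cocycle k (x : coh C k) z : mem_coh x z -> cocycle z.
Proof. by case: x => x [z' cz' xz']; rewrite /mem_coh /= xz' => -[]. Qed.

Lemma mem_coh_cobounds k (x : coh C k) u v :
  mem_coh x u -> mem_coh x v -> coboundary (u - v).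
Proof.
case: x => x [z cz xz]; rewrite /mem_coh /= xz => -[_ uz] [_ vz].
by rewrite -(subrKA z); apply: coboundaryD => //; exact: coboundaryC.
Qed.

Lemma coh_mem_eq k (x y : coh C k) u v :
  mem_coh x u -> mem_coh y v -> coboundary (u - v) -> x = y.
Proof.
case: x => x ex; case: y => y ey; rewrite /mem_coh /= => xu yv uv.
apply: eq_exist; case: ex xu => z cz ->; case: ey yv => z' cz' ->.
move=> [_ vz'] [_ uz]; apply: cclass_eq.
rewrite -(subrKA u); apply: coboundaryD; first exact: coboundaryC.
by rewrite -(subrKA v); exact: coboundaryD.
Qed.

Lemma mem_coh_shift k (x : coh C k) u v :
  mem_coh x u -> cocycle v -> coboundary (u - v) -> mem_coh x v.
Proof.
move=> xu cv uv; rewrite (coh_mem_eq xu (mem_coh_of cv) uv); exact: mem_coh_of.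
Qed.

Lemma coh_is0P k (x : coh C k) z : mem_coh x z -> coh_is0 x <-> coboundary z.
Proof.
move=> xz; split=> [x0|bz].
  by have := mem_coh_cobounds xz x0; rewrite subr0.
by apply: (mem_coh_shift xz); [exact: cocycle0|rewrite subr0].
Qed.

End OneComplex.

(** A representative of each class is chosen; any other differs from it by a coboundary, which [phi]
    preserves. *)
Lemma coh_map (C D : complex R) (lC : linear_complex C) (lD : linear_complex D) j k
    (phi : cc C j -> cc D k) :
  (forall a u v, phi (a *: u + v) = a *: phi u + phi v) ->
  (forall z, cocycle z -> cocycle (phi z)) ->
  (forall z, coboundary z -> coboundary (phi z)) ->
  exists f : coh C j -> coh D k, coh_induced phi f /\ coh_linear f.
Proof.
move=> philin phiZ phiB.
have phiN u v : phi (u - v) = phi u - phi v.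
  by rewrite addrC -scaleN1r philin scaleN1r addrC.
pose rep (x : coh C j) := sval (cid (mem_coh_ex lC x)).
have repP x : mem_coh x (rep x) by exact: (svalP (cid (mem_coh_ex lC x))).
exists (fun x => coh_of (phiZ _ (mem_coh_cocycle (repP x)))).
have ind : coh_induced phi (fun x => coh_of (phiZ _ (mem_coh_cocycle (repP x)))).
  move=> x z xz.
  apply: (mem_coh_shift lD (mem_coh_of lD _)).
    exact/phiZ/mem_coh_cocycle/xz.
  by rewrite -phiN; apply: phiB; exact: (mem_coh_cobounds lC (repP x) xz).
split=> // a x y z [u [v [xu yv zuv]]].
exists (phi u), (phi v); split; [exact: ind xu|exact: ind yv|].
by rewrite -philin; exact: ind zuv.
Qed.

Lemma coh_exactP (B C D : complex R) (lB : linear_complex B) (lC : linear_complex C)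
    (lD : linear_complex D) i j k (phi : cc B i -> cc C j) (psi : cc C j -> cc D k)
    (f : coh B i -> coh C j) (g : coh C j -> coh D k) :
  coh_induced phi f -> coh_induced psi g ->
  (forall y, cocycle y ->
    coboundary (psi y) <-> exists2 x, cocycle x & coboundary (y - phi x)) ->
  coh_exact f g.
Proof.
move=> fphi gpsi E y; have [z yz] := mem_coh_ex lC y.
rewrite (coh_is0P lD (gpsi _ _ yz)) (E z (mem_coh_cocycle yz)); split.
  move=> [x cx bx]; exists (coh_of cx).
  exact: (coh_mem_eq lC (fphi _ _ (mem_coh_of lB cx)) yz (coboundaryC lC bx)).
move=> [x fxy]; have [u xu] := mem_coh_ex lB x; exists u.
  exact: mem_coh_cocycle xu.
by apply: (mem_coh_cobounds lC yz); rewrite -fxy; exact: fphi.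
Qed.

End CohomologyMaps.

(** * Cones of cochain maps, through components on composable strings *)

Section Cone.
Variables (R : realType) (T : nat -> Type) (S : forall k, set (T k)).

(** The common shape of [rep_complex] and [def_complex], which are instances of it by conversion. *)
Definition fun_complex (V : lmodType R) (A : forall k, set (T k -> V))
    (D : forall k, (T k -> V) -> T k.+1 -> V) : complex R :=
  @Complex R (fun k => T k -> V) A (fun k z => forall g, S g -> z g = 0) D.

Variables (Vd Vg Vt : lmodType R).
Variables (Ad : forall k, set (T k -> Vd)) (Ag : forall k, set (T k -> Vg))
  (At : forall k, set (T k -> Vt)).
Variables (Dd : forall k, (T k -> Vd) -> T k.+1 -> Vd)
  (Dg : forall k, (T k -> Vg) -> T k.+1 -> Vg)
  (Dt : forall k, (T k -> Vt) -> T k.+1 -> Vt).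
Arguments Dd {k} _ _. Arguments Dg {k} _ _. Arguments Dt {k} _ _.

(* The complex of the [Vt]-valued cochains shifted by one degree: index [k]
   stands for degree [k - 1], and degree [-1] is zero. *)
Definition shift_adm k : set (T k.-1 -> Vt) :=
  match k with 0 => [set w | forall g, w g = 0] | k'.+1 => @At k' end.

Definition shift_d k : (T k.-1 -> Vt) -> T k -> Vt :=
  match k with 0 => fun _ _ => 0 | k'.+1 => @Dt k' end.
Arguments shift_d {k} _ _.

(** [J] and [I] insert the two components of a cone cochain, [P] and [Q] extract them, and [rho] is
    the map whose cone is formed. *)
Variables (J : forall k, (T k -> Vg) -> T k -> Vd)
  (I : forall k, (T k.-1 -> Vt) -> T k -> Vd)
  (P : forall k, (T k -> Vd) -> T k -> Vg)
  (Q : forall k, (T k -> Vd) -> T k.-1 -> Vt)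
  (rho : forall k, (T k -> Vg) -> T k -> Vt).
Arguments J {k} _ _. Arguments I {k} _ _. Arguments P {k} _ _.
Arguments Q {k} _ _. Arguments rho {k} _ _.

Definition pointwise_linear j k (V W : lmodType R)
    (f : (T j -> V) -> T k -> W) : Prop :=
  forall a u v, f (a *: u + v) = a *: f u + f v.

(** Such maps respect the identification of cochains that agree on composable strings. *)
Definition local j k (V W : lmodType R) (f : (T j -> V) -> T k -> W) : Prop :=
  forall u v, (forall g, @S j g -> u g = v g) -> forall g, @S k g -> f u g = f v g.

Hypotheses
  (Ag0 : forall k, @Ag k 0) (At0 : forall k, @At k 0)
  (Agl : forall k a u v, @Ag k u -> @Ag k v -> @Ag k (a *: u + v))
  (Atl : forall k a u v, @At k u -> @At k v -> @At k (a *: u + v))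
  (Ad_eq : forall k u v, (forall g, @S k g -> u g = v g) -> Ad u -> Ad v)
  (Dgl : forall k, pointwise_linear (@Dg k))
  (Dtl : forall k, pointwise_linear (@Dt k))
  (Jl : forall k, pointwise_linear (@J k))
  (Il : forall k, pointwise_linear (@I k))
  (Pl : forall k, pointwise_linear (@P k))
  (Ql : forall k, pointwise_linear (@Q k))
  (rhol : forall k, pointwise_linear (@rho k))
  (Ddx : forall k, local (@Dd k))
  (Jx : forall k, local (@J k)) (Ix : forall k, local (@I k))
  (Px : forall k, local (@P k)) (Qx : forall k, local (@Q k.+1))
  (rhox : forall k, local (@rho k))
  (rhoA : forall k v, @Ag k v -> At (rho v))
  (PA : forall k c, @Ad k c -> Ag (P c))
  (QA : forall k c, @Ad k c -> shift_adm (Q c))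
  (JIA : forall k v w, @Ag k v -> @shift_adm k w -> Ad (J v + I w))
  (dec : forall k c, @Ad k c -> forall g, S g -> c g = J (P c) g + I (Q c) g)
  (PJI : forall k (v : T k -> Vg) w g, S g -> P (J v + I w) g = v g)
  (QJI : forall k (v : T k.+1 -> Vg) w g, S g -> Q (J v + I w) g = w g)
  (DJI : forall k (v : T k -> Vg) w g, S g ->
     Dd (J v + I w) g = J (Dg v) g - I (rho v + shift_d w : T k.+1.-1 -> Vt) g)
  (rhoD : forall k (v : T k -> Vg) g, S g -> rho (Dg v) g = Dt (rho v) g).

Let Cd := fun_complex Ad (@Dd).
Let Cg := fun_complex Ag (@Dg).
Let Ct := fun_complex At (@Dt).

Lemma pointwise_linear0 j k (V W : lmodType R) (f : (T j -> V) -> T k -> W) :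
  pointwise_linear f -> f 0 = 0.
Proof.
by move=> /(_ (-1) 0 0); rewrite scaleN1r addNr scaleN1r addNr.
Qed.

Lemma pointwise_linearN j k (V W : lmodType R) (f : (T j -> V) -> T k -> W) u :
  pointwise_linear f -> f (- u) = - f u.
Proof.
move=> fl; have := fl (-1) u 0.
by rewrite addr0 !scaleN1r (pointwise_linear0 fl) addr0.
Qed.

Lemma pointwise_linearD j k (V W : lmodType R) (f : (T j -> V) -> T k -> W) u v :
  pointwise_linear f -> f (u + v) = f u + f v.
Proof. by move=> /(_ 1 u v); rewrite !scale1r. Qed.

Lemma shift_dl k : pointwise_linear (@shift_d k).
Proof.
case: k => [|k] a u v; last exact: Dtl.
by rewrite /shift_d; apply/funext => g; rewrite !fctE scaler0 addr0.
Qed.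

Lemma shift_adm0 k : @shift_adm k 0.
Proof. by case: k => [|k] //=; exact: At0. Qed.

Lemma shift_adml k a u v : @shift_adm k u -> @shift_adm k v -> @shift_adm k (a *: u + v).
Proof.
case: k u v => [|k] u v /=; last exact: Atl.
by move=> u0 v0 g; rewrite !fctE u0 v0 scaler0 addr0.
Qed.

Lemma shift_admN k u : @shift_adm k u -> @shift_adm k (- u).
Proof.
by move=> Au; rewrite -[- u]addr0 -scaleN1r; apply: shift_adml => //; exact: shift_adm0.
Qed.

Lemma fun_complex_linear (V : lmodType R) (A : forall k, set (T k -> V))
    (D : forall k, (T k -> V) -> T k.+1 -> V) :
  (forall k, @A k 0) ->
  (forall k a u v, @A k u -> @A k v -> @A k (a *: u + v)) ->
  (forall k a u v g, @A k u -> @A k v -> @S k.+1 g ->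
     D k (a *: u + v) g = a *: D k u g + D k v g) ->
  linear_complex (fun_complex A D).
Proof.
move=> A0 Al Dl; split=> //=.
- by move=> k a u v nu nv g Sg; rewrite !fctE nu// nv// scaler0 addr0.
- by move=> k a u v Au Av g Sg; rewrite !fctE Dl// subrr.
Qed.

Lemma linear_Cg : linear_complex Cg.
Proof.
by apply: fun_complex_linear => [//|//|k a u v g _ _ _]; rewrite Dgl.
Qed.

Lemma linear_Ct : linear_complex Ct.
Proof.
by apply: fun_complex_linear => [//|//|k a u v g _ _ _]; rewrite Dtl.
Qed.

Lemma Dd_dec k c g : @Ad k c -> S g ->
  Dd c g = J (Dg (P c)) g - I (rho (P c) + shift_d (Q c) : T k.+1.-1 -> Vt) g.
Proof.
by move=> Ac Sg; rewrite -DJI//; apply: Ddx Sg => h Sh; rewrite dec.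
Qed.

(** An admissible cochain is determined on [S] by its components; these depend linearly on it, and
    [Dd_dec] expresses [Dd] linearly in them. *)
Lemma linear_Cd : linear_complex Cd.
Proof.
have Al k a u v : @Ad k u -> @Ad k v -> @Ad k (a *: u + v).
  move=> Au Av; apply: (@Ad_eq _ (J (a *: P u + P v) + I (a *: Q u + Q v))).
    move=> g Sg; rewrite Jl Il !fctE (dec Au Sg) (dec Av Sg).
    by rewrite scalerDr addrACA.
  apply: JIA; first by apply: Agl; exact: PA.
  by apply: shift_adml; exact: QA.
apply: fun_complex_linear => // [k|k a u v g Au Av Sg].
  apply: (@Ad_eq _ (J 0 + I 0)).
    by move=> g _; rewrite (pointwise_linear0 (@Jl k)) (pointwise_linear0 (@Il k)) addr0.
  by apply: JIA; [exact: Ag0|exact: shift_adm0].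
rewrite (Dd_dec (Al _ a _ _ Au Av) Sg) (Dd_dec Au Sg) (Dd_dec Av Sg).
rewrite Pl Ql Dgl rhol shift_dl Jl.
rewrite (_ : _ + _ + _ = a *: (rho (P u) + shift_d (Q u)) + (rho (P v) + shift_d (Q v))); last first.
  by rewrite scalerDr addrACA.
by rewrite Il !fctE scalerBr opprD addrACA.
Qed.

(** In degree 0 the shifted complex vanishes and coboundaries are the null cochains, so both sides
    say that [w] is zero on [S]; later arguments then treat degree 0 like the others. *)
Lemma coboundary_shift k (w : T k -> Vt) :
  @coboundary _ Ct k w <->
  exists2 b, @shift_adm k b & forall g, S g -> w g = shift_d b g.
Proof.
case: k w => [|k] w; split.
- by move=> w0; exists 0 => // g Sg; rewrite w0.
- by move=> [b _ wb] g Sg; rewrite wb.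
- by move=> [b Ab wb]; exists b => // g Sg; apply/subr0_eq; exact: wb.
- by move=> [b Ab wb]; exists b => // g Sg; rewrite !fctE wb// subrr.
Qed.

Theorem cone_long_exact :
  exists (iota : forall k, coh Ct k -> coh Cd k.+1)
         (pi : forall k, coh Cd k -> coh Cg k)
         (r : forall k, coh Cg k -> coh Ct k),
    (forall k, coh_linear (iota k) /\ coh_linear (pi k) /\ coh_linear (r k)) /\
    (forall k, coh_induced (@rho k : cc Cg k -> cc Ct k) (r k)) /\
    (forall x : coh Cd 0%N, coh_is0 (pi 0%N x) <-> coh_is0 x) /\
    (forall k, coh_exact (iota k) (pi k.+1)) /\
    (forall k, coh_exact (pi k) (r k)) /\
    (forall k, coh_exact (r k) (iota k)).
Proof.
have lCd := linear_Cd; have lCg := linear_Cg; have lCt := linear_Ct.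
have JI k (v : T k -> Vg) : J v = J v + I 0.
  by rewrite (pointwise_linear0 (@Il k)) addr0.
have IJ k w : I w = J 0 + I w :> (T k -> Vd).
  by rewrite (pointwise_linear0 (@Jl k)) add0r.
have DI k (w : T k -> Vt) g : S g -> Dd (@I k.+1 w) g = - @I k.+2 (Dt w) g.
  move=> Sg; rewrite IJ DJI// (pointwise_linear0 (@Dgl _)).
  by rewrite (pointwise_linear0 (@Jl _)) (pointwise_linear0 (@rhol _)) !add0r.
have fB (V : lmodType R) k (u v : T k -> V) g : (u - v) g = u g - v g by [].
have fD (V : lmodType R) k (u v : T k -> V) g : (u + v) g = u g + v g by [].
have fN (V : lmodType R) k (u : T k -> V) g : (- u) g = - u g by [].
have sub0 (V : lmodType R) k (u v : T k -> V) :
    (forall g, S g -> (u - v) g = 0) <-> (forall g, S g -> u g = v g).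
  split=> uv g Sg; first exact/subr0_eq/uv.
  by rewrite !fctE uv// subrr.
have rho0 k (z : T k -> Vg) : (forall g, S g -> z g = 0) ->
    forall g, S g -> rho z g = 0.
  by move=> z0 g Sg; rewrite (rhox (v := 0) z0 Sg) (pointwise_linear0 (@rhol _)).
have J0 k (z : T k -> Vg) : (forall g, S g -> z g = 0) ->
    forall g, S g -> J z g = 0.
  by move=> z0 g Sg; rewrite (Jx (v := 0) z0 Sg) (pointwise_linear0 (@Jl _)).
have I0 k (z : T k -> Vt) : (forall g, S g -> z g = 0) ->
    forall g, S g -> @I k.+1 z g = 0.
  by move=> z0 g Sg; rewrite (@Ix k.+1 z 0 z0 g Sg) (pointwise_linear0 (@Il _)).
(* The next two facts read the components of the differential: [P] is a cochain map, while [Q]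
   anticommutes with the differentials up to the term [rho (P c)]. *)
have PD k (c : T k -> Vd) g : Ad c -> S g -> P (Dd c) g = Dg (P c) g.
  move=> Ac Sg; rewrite -[RHS](PJI (Dg (P c)) (- (rho (P c) + shift_d (Q c))) Sg).
  apply: Px Sg => h Sh; rewrite (Dd_dec Ac Sh).
  by rewrite (pointwise_linearN _ (@Il _)).
have QD k (c : T k -> Vd) g : Ad c -> S g ->
    Q (Dd c) g = - (rho (P c) + shift_d (Q c)) g.
  move=> Ac Sg; rewrite -[RHS](QJI (Dg (P c)) (- (rho (P c) + shift_d (Q c))) Sg).
  apply: (Qx _ (g := g)) => // h Sh; rewrite (Dd_dec Ac Sh).
  by rewrite (pointwise_linearN _ (@Il _)).
have Jz k g : J (0 : T k -> Vg) g = 0 by rewrite (pointwise_linear0 (@Jl _)).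
have rhoB k (z : cc Cg k) : coboundary z -> @coboundary _ Ct k (rho z).
  case: k z => [|k] z /=; first exact: rho0.
  move=> [b Ab /sub0 zb]; exists (rho b); first exact: rhoA.
  apply/sub0 => g Sg; rewrite -rhoD//; exact (@rhox _ _ _ zb g Sg).
have ex_rho k : exists f : coh Cg k -> coh Ct k,
    coh_induced (@rho k : cc Cg k -> cc Ct k) f /\ coh_linear f.
  apply: coh_map => //; first exact: rhol.
  - move=> z [Az dz]; split; first exact: rhoA.
    by move=> g Sg; rewrite /= -rhoD//; apply: rho0 Sg; exact: dz.
  - exact: rhoB.
have ex_pi k : exists f : coh Cd k -> coh Cg k,
    coh_induced (@P k : cc Cd k -> cc Cg k) f /\ coh_linear f.
  have P0 j (c : T j -> Vd) : (forall g, S g -> c g = 0) ->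
      forall g, S g -> P c g = 0.
    by move=> z0 g Sg; rewrite (Px (v := 0) z0 Sg) (pointwise_linear0 (@Pl _)).
  apply: coh_map => //; first exact: Pl.
  - move=> z [Az dz]; split; first exact: PA.
    by move=> g Sg; rewrite /= -PD//; apply: P0 Sg; exact: dz.
  - case: k => [|k] z /=; first exact: P0.
    move=> [b Ab /sub0 zb]; exists (P b); first exact: PA.
    apply/sub0 => g Sg; rewrite -PD//; exact (@Px _ _ _ zb g Sg).
have ex_iota k : exists f : coh Ct k -> coh Cd k.+1,
    coh_induced (@I k.+1 : cc Ct k -> cc Cd k.+1) f /\ coh_linear f.
  apply: coh_map => //; first exact (@Il k.+1).
  - move=> z [Az dz]; split.
      by rewrite IJ; apply: JIA => //; exact: Ag0.
    by move=> g Sg; rewrite /= DI// (I0 _ _ dz)// oppr0.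
  (* The sign compensates for the anticommutation of [I]: the differential of [I b] is minus [I] of
     that of [b]. *)
  - move=> z /coboundary_shift [b Ab zb]; exists (J 0 + I (- b)).
      by apply: JIA; [exact: Ag0|exact: shift_admN].
    apply/sub0 => g Sg; rewrite /= DJI// (pointwise_linear0 (@Dgl _)).
    rewrite Jz (pointwise_linear0 (@rhol _)) !add0r.
    rewrite (pointwise_linearN _ (@shift_dl _)) (pointwise_linearN _ (@Il _)) opprK.
    exact (@Ix k.+1 _ _ zb g Sg).
pose pi k := sval (cid (ex_pi k)).
have [piP piL] : (forall k, coh_induced (@P k : cc Cd k -> cc Cg k) (pi k)) /\
    (forall k, coh_linear (pi k)).
  by split=> k; have [] := svalP (cid (ex_pi k)).
pose iota k := sval (cid (ex_iota k)).
have [iP iL] : (forall k, coh_induced (@I k.+1 : cc Ct k -> cc Cd k.+1) (iota k)) /\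
    (forall k, coh_linear (iota k)).
  by split=> k; have [] := svalP (cid (ex_iota k)).
pose r k := sval (cid (ex_rho k)).
have [rP rL] : (forall k, coh_induced (@rho k : cc Cg k -> cc Ct k) (r k)) /\
    (forall k, coh_linear (r k)).
  by split=> k; have [] := svalP (cid (ex_rho k)).
exists iota, pi, r; split; first by move=> k; split; [exact: iL|split; [exact: piL|exact: rL]].
split; first exact: rP.
split.
  (* In degree 0 there is no second component, so [c] vanishes on [S] exactly when [P c] does; this
     is the vanishing of cohomology in degree -1. *)
  move=> x; have [c xc] := mem_coh_ex lCd x.
  have [Ac _] := mem_coh_cocycle xc.
  rewrite (coh_is0P lCg (piP _ _ _ xc)) (coh_is0P lCd xc) /=; split=> c0 g Sg.
    have E : I (Q c) g = 0.
      by rewrite (_ : Q c = 0) ?(pointwise_linear0 (@Il _))//; apply/funext; exact: (QA Ac).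
    by rewrite (dec Ac Sg) E addr0 J0.
  by rewrite (Px (v := 0) c0 Sg) (pointwise_linear0 (@Pl _)).
split.
  move=> k; apply: (coh_exactP lCt lCd lCg (iP k) (piP k.+1)) => y [Ay dy].
  split.
    (* As [Dd (J b) = J (Dg b) - I (rho b)] with [Dg b = P y], subtracting it from [y] leaves
       [I (Q y + rho b)]. The second component of [Dd y = 0] says that this is a cocycle. *)
    move=> [b Ab /sub0 yb]; exists (Q y + rho b).
      split.
        by rewrite -[Q y]scale1r; apply: Atl; [exact: (QA Ay)|exact: rhoA].
      move=> g Sg; rewrite /= (pointwise_linearD _ _ (@Dtl _)) !fctE -rhoD//.
      rewrite -(rhox yb Sg).
      have := QD _ y g Ay Sg.
      rewrite (Qx (v := 0) dy Sg) (pointwise_linear0 (@Ql _)) => /esym/eqP.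
      by rewrite oppr_eq0 !fctE addrC => /eqP.
    exists (J b + I 0); first by apply: JIA => //; exact: shift_adm0.
    apply/sub0 => g Sg; rewrite /= DJI// (pointwise_linear0 (@shift_dl _)) addr0.
    rewrite fB (dec Ay Sg) (Jx yb Sg) (pointwise_linearD _ _ (@Il k.+1)) fD.
    by rewrite opprD !addrA addrK.
  move=> [w [Aw dw] [c Ac /sub0 yc]]; exists (P c); first exact: PA.
  apply/sub0 => g Sg; rewrite /= -PD//.
  have E h : S h -> y h = (@I k.+1 w + Dd c) h.
    by move=> Sh; rewrite fD -[Dd c h]yc// fB addrC subrK.
  by rewrite (Px E Sg) (pointwise_linearD _ _ (@Pl _)) fD IJ PJI// add0r.
split.
  move=> k; apply: (coh_exactP lCd lCg lCt (piP k) (rP k)) => y [Ay dy]; split.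
    (* A primitive [b] of [rho y] completes [y] to the cone cocycle (y, -b), since rho y + d(-b) =
       0. *)
    move=> /coboundary_shift [b Ab yb].
    have Ac : Ad (J y + I (- b)) by apply: JIA => //; exact: shift_admN.
    exists (J y + I (- b)).
      split=> // g Sg; rewrite /= DJI// (J0 _ _ dy)// I0 ?subr0// => h Sh.
      by rewrite (pointwise_linearN _ (@shift_dl _)) !fctE yb// subrr.
    by apply: (coboundary_nul lCg); apply/sub0 => g Sg; rewrite PJI.
  move=> [c [Ac dc] bc].
  rewrite -(subrK (P c) y) (pointwise_linearD _ _ (@rhol _)).
  apply: (coboundaryD lCt); first exact: rhoB.
  (* For a cone cocycle the second component of [Dd c = 0] reads [rho (P c) = - shift_d (Q c)]. *)
  apply/coboundary_shift; exists (- Q c); first exact/shift_admN/QA.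
  move=> g Sg; rewrite (pointwise_linearN _ (@shift_dl _)).
  have := QD _ c g Ac Sg.
  rewrite (Qx (v := 0) dc Sg) (pointwise_linear0 (@Ql _)) => /esym/eqP.
  by rewrite oppr_eq0 !fctE addr_eq0 => /eqP.
move=> k; apply: (coh_exactP lCg lCt lCd (rP k) (iP k)) => y [Ay dy]; split.
  move=> [c Ac /sub0 yc].
  (* Comparing components in [I y = Dd c]: the first makes [P c] a cocycle, the second gives y =
     rho(-P c) + d(-Q c), whence the two witnesses below. *)
  have E g : S g -> y g = - (rho (P c) + shift_d (Q c)) g.
    move=> Sg; rewrite -QD// -(Qx yc Sg) IJ QJI//.
  exists (- P c).
    split; first by rewrite -[- P c]addr0 -scaleN1r; apply: Agl; [exact: PA|exact: Ag0].
    move=> g Sg; rewrite /= (pointwise_linearN _ (@Dgl _)) !fctE -PD//.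
    by rewrite -(Px yc Sg) IJ PJI// oppr0.
  apply/coboundary_shift; exists (- Q c); first exact/shift_admN/QA.
  move=> g Sg; rewrite !fctE E// (pointwise_linearN _ (@shift_dl _)).
  by rewrite (pointwise_linearN _ (@rhol _)) !fctE opprK opprD addrAC addNr add0r.
move=> [v [Av dv] /coboundary_shift [b Ab vb]].
(* With [v] closed, the differential of this cochain is [I (rho v + shift_d b)], which is [I y];
   both minus signs cancel the one in [DJI]. *)
exists (J (- v) + I (- b)).
  apply: JIA; last exact: shift_admN.
  by rewrite -[- v]addr0 -scaleN1r; apply: Agl => //; exact: Ag0.
apply/sub0 => g Sg; rewrite /= DJI// (pointwise_linearN _ (@Dgl _)) (pointwise_linearN _ (@Jl _)).
rewrite (pointwise_linearN _ (@rhol _)) (pointwise_linearN _ (@shift_dl _)).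
rewrite -[- rho v - _]opprD (pointwise_linearN _ (@Il k.+1)) !fN (J0 _ _ dv)// oppr0 sub0r opprK.
apply: (@Ix k.+1 _ _ _ g Sg) => h Sh.
by rewrite fD -vb// fB addrC subrK.
Qed.

End Cone.

(** * Deformation cochains of an action groupoid *)

Section ActionComplexes.
Context {R : realType} {G : lie_group R} {M : manifold R} (a : lie_action G M).
Local Notation aG := (manifold_atlas G).
Local Notation aM := (manifold_atlas M).
Local Notation aA := (@arr_atlas R G M).
Local Notation e := (lone G).
Local Notation H := (action_groupoid a).
Local Notation T := (nerve H).
Local Notation N := (fun n => Topological.sort (nerve H n)).
Local Notation Vg := 'rV[R]_(mdim G).
Local Notation Vt := 'rV[R]_(mdim M).
Local Notation Vd := 'rV[R]_(mdim G + mdim M).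

(** Forgets g_1; in degree 1 what remains is the source of the arrow, since the nerve starts with
    the objects. *)
Definition tail k : T k.+1 -> T k :=
  match k return T k.+1 -> T k with 0 => fun g => g.1.2 | k'.+1 => fun g => g.2 end.

(* [(g_1, ..., g_k) |-> (1, g_1, ..., g_k)]: by projectability, the T M component
   of a deformation cochain is determined by its values on these strings. *)
Definition lift_unit k : T k -> T k.+1 :=
  match k return T k -> T k.+1 with
  | 0 => fun x => ((e, x), 0)
  | k'.+1 => fun g => ((e, gt g.1), g)
  end.

Lemma nset_tail k (g : T k.+1) : nset g -> nset (tail g).
Proof. by case: k g => [|k] //= g []. Qed.

Lemma nset_lift k (g : T k) : nset g -> nset (lift_unit g).
Proof. by case: k g => [|k] //= g Sg. Qed.

Lemma tail_lift k (g : T k) : tail (lift_unit g) = g.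
Proof. by case: k g. Qed.

Lemma lift_tail k (g : T k.+1) : nset g ->
  gs g.1 = gs (lift_unit (tail g)).1 /\ g.2 = (lift_unit (tail g)).2.
Proof.
case: k g => [|k] g /=; last by case.
(* In degree 1 the end of the string is a row vector of length zero, hence equal to [0]. *)
by move=> _; split=> //; rewrite thinmx0.
Qed.

Lemma target_tail k (g : T k.+1) : nset g -> target (tail g) = g.1.2.
Proof. by case: k g => [|k] //= g []. Qed.

(** Only the first contraction alters g_1, and there composability and the action law give the same
    target. *)
Lemma target_gcontract i k (g : T k.+2) : (i <= k)%N -> nset g ->
  target (@gcontract R H i k g : T k.+1) = target g.
Proof.
case: i k g => [|i] [|k] //= g _ [E _]; by rewrite lactM -E.
Qed.

Lemma nset_gcontract i k (g : T k.+2) : (i <= k)%N -> nset g ->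
  nset (@gcontract R H i k g : T k.+1).
Proof.
elim: i k g => [|i IH] [|k] //= g; first by move=> _ [E [E' C]].
rewrite ltnS => ik [E C]; split; last exact: IH.
by rewrite E; have := target_gcontract ik C.
Qed.

Lemma nset_droplast k (g : T k.+2) : nset g -> nset (@droplast R H k.+1 g : T k.+1).
Proof.
elim: k g => [|k IH] //= g [E C]; split; last exact: (IH g.2).
by rewrite E.
Qed.

Lemma nset_tl k (g : T k.+2) : nset g -> nset (g.2 : T k.+1).
Proof. by case. Qed.

Lemma strings_atlas k : has_atlas (strings H k).
Proof. by elim: k => [|k IH]; [exact: euclid_atlas|exact: prodm_atlas aA IH]. Qed.

Lemma nerve_atlas k : has_atlas (T k).
Proof. case: k => [|k]; [exact: aM|exact: strings_atlas k.+1]. Qed.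

(** Translation by the inverse brings the group component back to the unit; the sign in degree 0 is
    the one of [of_gpart]. *)
Definition gpart k : (T k -> Vd) -> T k -> Vg :=
  match k return (T k -> Vd) -> T k -> Vg with
  | 0 => fun al x => - lsubmx (al x)
  | k'.+1 => fun c g => mulR (linv g.1.1) g.1.1 (lsubmx (c g))
  end.

Definition tpart k : (T k -> Vd) -> T k.-1 -> Vt :=
  match k return (T k -> Vd) -> T k.-1 -> Vt with
  | 0 => fun _ _ => 0
  | k'.+1 => fun c g => rsubmx (c (lift_unit g))
  end.

(* In degree 0 the sign turns [delta(al) = right_inv al + left_inv al] into the
   cone differential of the other degrees. *)
Definition of_gpart k : (T k -> Vg) -> T k -> Vd :=
  match k return (T k -> Vg) -> T k -> Vd with
  | 0 => fun v x => row_mx (- v x) 0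
  | k'.+1 => fun v g => row_mx (mulR g.1.1 e (v g)) 0
  end.

Definition of_tpart k : (T k.-1 -> Vt) -> T k -> Vd :=
  match k return (T k.-1 -> Vt) -> T k -> Vd with
  | 0 => fun _ _ => 0
  | k'.+1 => fun w g => row_mx 0 (w (tail g))
  end.

Lemma mulR_lin (k h : G) b u v : mulR k h (b *: u + v) = b *: mulR k h u + mulR k h v.
Proof. exact: linearP. Qed.

Lemma inf_action_lin x b u v :
  inf_action a x (b *: u + v) = b *: inf_action a x u + inf_action a x v.
Proof. by rewrite !inf_actionE; exact: linearP. Qed.

Lemma gpart_lin k : pointwise_linear (T := N) (@gpart k).
Proof.
case: k => [|k] b u v; apply/funext => g /=.
  have -> : lsubmx ((b *: u + v) g) = b *: lsubmx (u g) + lsubmx (v g).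
    exact: linearP.
  by rewrite opprD -scalerN.
have -> : lsubmx ((b *: u + v) g) = b *: lsubmx (u g) + lsubmx (v g).
  exact: linearP.
exact: mulR_lin.
Qed.

Lemma tpart_lin k : pointwise_linear (T := N) (@tpart k).
Proof.
case: k => [|k] b u v; apply/funext => g /=; last exact: linearP.
exact (esym (etrans (addr0 _) (scaler0 _ _))).
Qed.

Lemma row_mx_lin m n b (u v : 'rV[R]_m) (u' v' : 'rV[R]_n) :
  row_mx (b *: u + v) (b *: u' + v') = b *: row_mx u u' + row_mx v v'.
Proof. by rewrite scale_row_mx add_row_mx. Qed.

Lemma lin0 n b : 0 = b *: 0 + 0 :> 'rV[R]_n.
Proof. by rewrite scaler0 addr0. Qed.

Lemma of_gpart_lin k : pointwise_linear (T := N) (@of_gpart k).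
Proof.
case: k => [|k] b u v; apply/funext => g; refine (etrans _ (row_mx_lin _ _ _ _ _)).
  by rewrite /= -lin0 opprD -scalerN.
by rewrite -lin0 -mulR_lin.
Qed.

Lemma of_tpart_lin k : pointwise_linear (T := N) (@of_tpart k).
Proof.
case: k => [|k] b u v; apply/funext => g; first exact: lin0.
by refine (etrans _ (row_mx_lin _ _ _ _ _)); rewrite -lin0.
Qed.

Lemma gpart_local k : local (T := N) (@nset R H) (@gpart k).
Proof. by case: k => [|k] u v uv g Sg /=; rewrite uv. Qed.

Lemma tpart_local k : local (T := N) (@nset R H) (@tpart k.+1).
Proof. by move=> u v uv g Sg /=; rewrite uv//; exact: nset_lift. Qed.

Lemma of_gpart_local k : local (T := N) (@nset R H) (@of_gpart k).
Proof. by case: k => [|k] u v uv g Sg /=; rewrite uv. Qed.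

Lemma of_tpart_local k : local (T := N) (@nset R H) (@of_tpart k).
Proof. by case: k => [|k] u v uv g Sg //=; rewrite uv//; exact: nset_tail. Qed.

Lemma gpart_of k (v : T k -> Vg) w g : gpart (of_gpart v + of_tpart w) g = v g.
Proof.
case: k v w g => [|k] v w g /=; rewrite fctE.
  by rewrite addr0 row_mxKl opprK.
by rewrite add_row_mx addr0 row_mxKl mulRK.
Qed.

Lemma tpart_of k (v : T k.+1 -> Vg) w g : tpart (of_gpart v + of_tpart w) g = w g.
Proof. by rewrite /= fctE add_row_mx add0r row_mxKr tail_lift. Qed.

End ActionComplexes.

(** * The deformation differential in components *)

Section ActionDifferentials.
Context {R : realType} {G : lie_group R} {M : manifold R} (a : lie_action G M).
Local Notation e := (lone G).
Local Notation H := (action_groupoid a).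
Local Notation T := (nerve H).
Local Notation N := (fun n => Topological.sort (nerve H n)).
Local Notation Vg := 'rV[R]_(mdim G).
Local Notation Vt := 'rV[R]_(mdim M).
Local Notation Vd := 'rV[R]_(mdim G + mdim M).
Local Notation rho := (@inf_action_cochain R G M a).

Lemma rep_d_lin (E : representation H) k :
  (forall g b u v, @gact R H E g (b *: u + v) = b *: @gact R H E g u + @gact R H E g v) ->
  pointwise_linear (T := N) (@rep_d R H E k).
Proof.
move=> lE b u v; apply/funext => g.
(* The combination is replaced by a variable known through its values, so that it can be expanded at
   each string separately. *)
suff: forall f, (forall x, f x = b *: u x + v x) ->
    rep_d (E := E) f g = b *: rep_d (E := E) u g + rep_d (E := E) v g by apply.
move=> f fE.
case: k u v f g fE => [|k] u v f g fE /=.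
  by rewrite !fE lE opprD -scalerN addrACA -scalerDr.
have Z (c : R) x : c *: f x = b *: (c *: u x) + c *: v x.
  by rewrite fE scalerDr !scalerA mulrC.
rewrite Z fE lE; under eq_bigr => i _ do rewrite Z.
rewrite big_split /= -scaler_sumr -[LHS]addrA [X in _ + X]addrACA [LHS]addrACA.
by rewrite !scalerDr !addrA.
Qed.

Lemma inf_action_cochain_lin k : pointwise_linear (T := N) (@inf_action_cochain R G M a k).
Proof. by move=> b u v; apply/funext => g; exact: inf_action_lin. Qed.

Lemma inf_action_cochain_local k :
  local (T := N) (@nset R H) (@inf_action_cochain R G M a k).
Proof. by move=> u v uv g Sg; rewrite /inf_action_cochain uv. Qed.

Lemma inf_actionD x u v : inf_action a x (u + v) = inf_action a x u + inf_action a x v.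
Proof. by rewrite !inf_actionE; exact: tmapD. Qed.

Lemma inf_actionN x u : inf_action a x (- u) = - inf_action a x u.
Proof. by rewrite !inf_actionE; exact: tmapN. Qed.

Lemma inf_actionZ x b u : inf_action a x (b *: u) = b *: inf_action a x u.
Proof. by rewrite !inf_actionE; exact: tmapZ. Qed.

Lemma inf_action_sum x (J : Type) (r : seq J) (P : pred J) F :
  inf_action a x (\sum_(i <- r | P i) F i) = \sum_(i <- r | P i) inf_action a x (F i).
Proof.
rewrite inf_actionE /actL tmap_sum; apply: eq_bigr => i _; by rewrite inf_actionE.
Qed.

(** Equivariance handles the term with the action of g_1; contractions and dropping the last arrow
    keep the target, so there rho acts in a fixed fibre and linearity suffices. *)
Lemma inf_action_cochain_d k (v : T k -> Vg) g : nset g ->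
  rho (rep_d (E := rep_g a) v) g = rep_d (E := rep_T a) (rho v) g.
Proof.
rewrite /inf_action_cochain; case: k v g => [|k] v g Sg /=.
  rewrite inf_actionD inf_actionN; congr (_ - _).
  exact/esym/inf_action_equivariant.
rewrite !inf_actionD inf_actionZ inf_action_sum; congr (_ + _ + _).
  have E : g.1.2 = a g.2.1.1 g.2.1.2 by case: Sg.
  rewrite -E; exact (esym (inf_action_equivariant a g.1.1 g.1.2 (v g.2))).
rewrite [LHS]big_nat [RHS]big_nat; apply: eq_bigr => i /andP[i0 ik].
have ik' : (i.-1 <= k)%N by case: i i0 ik.
rewrite inf_actionZ.
exact (congr1 (fun x => (-1) ^+ i *: inf_action a x (v (gcontract i.-1 g)))
  (esym (target_gcontract ik' Sg))).
Qed.

Lemma def_d_local k : local (T := N) (@nset R H) (@def_d R H k).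
Proof.
case: k => [|k] u v uv g Sg.
  by have -> : u = v by apply/funext => x; exact: uv.
rewrite /= (uv g.2 (nset_tl Sg)) (uv _ (nset_droplast Sg)).
rewrite (uv _ (@nset_gcontract _ _ _ a 0 k g isT Sg)); congr (_ + _ + _).
rewrite [LHS]big_nat [RHS]big_nat; apply: eq_bigr => i /andP[i0 ik].
by rewrite uv//; apply: nset_gcontract => //; case: i i0 ik.
Qed.

Lemma row_mx_sum m n (J : Type) (r : seq J) (P : pred J) (c : J -> R)
    (u : J -> 'rV[R]_m) (v : J -> 'rV[R]_n) :
  \sum_(i <- r | P i) c i *: row_mx (u i) (v i) =
  row_mx (\sum_(i <- r | P i) c i *: u i) (\sum_(i <- r | P i) c i *: v i).
Proof.
elim: r => [|i r IH]; first by rewrite !big_nil row_mx0.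
rewrite !big_cons; case: (P i) => //.
by rewrite IH scale_row_mx add_row_mx.
Qed.

(** Face i of the string without g_1 is the tail of face i + 1 of the full string. This shift of
    index flips the signs and starts the sum at 2, as in [def_d]. *)
Lemma rep_d_tail k (w : T k -> Vt) (g : T k.+2) : nset g ->
  rep_d (E := rep_T a) w (g.2 : T k.+1) =
  actR a g.2.1.1 g.2.1.2 (w (tail (g.2 : T k.+1)))
  - \sum_(2 <= i < k.+2) (-1) ^+ i *: w (tail (@gcontract R H i.-1 k g : T k.+1))
  - (-1) ^+ k.+2 *: w (tail (@droplast R H k.+1 g : T k.+1)).
Proof.
case: k w g => [|k] w g [E Sg].
  rewrite big_geq// subr0 expr2 mulN1r opprK scale1r.
  have E' : g.1.2 = a g.2.1.1 g.2.1.2 := E.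
  by rewrite /= E'.
have sgnS n : (-1) ^+ n.+1 = - (-1) ^+ n :> R by rewrite exprS mulN1r.
rewrite big_add1 /= (sgnS k.+2) scaleNr opprK; congr (_ + _ + _).
rewrite -sumrN; apply: eq_big_nat => i /andP[i0 ik].
by case: i i0 ik => // i _ _; rewrite (sgnS i.+1) scaleNr opprK.
Qed.

(** This is the cone formula. The division term supplies the two terms of delta v that involve g_1
    g_2 and the action of g_1, and in the M-component - rho v together with the leading term of -
    delta w. *)
Lemma def_d_of k (v : T k -> Vg) (w : T k.-1 -> Vt) g : nset g ->
  def_d (of_gpart v + of_tpart w) g =
  of_gpart (rep_d (E := rep_g a) v) g -
  of_tpart (k := k.+1) (rho v + shift_d (T := N) (@rep_d R H (rep_T a)) (k := k) w) g.
Proof.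
case: k v w g => [|k] v w g Sg.
  (* For al = (-v, 0) and g: x -> gx, right translation contributes - R_g v(gx), and left
     translation contributes L_g v(x) = R_g Ad_g v(x) with M-component - rho v(x). *)
  have al x : (of_gpart v + of_tpart w) x = row_mx (- v x) 0 by rewrite fctE /= addr0.
  have r := @right_inv_action R G M a _ g.1 _ (al _).
  have l := @left_inv_action R G M a _ g.1 _ (al _).
  refine (etrans (f_equal2 +%R r l) _).
  rewrite add_row_mx /= add0r opp_row_mx add_row_mx oppr0 addr0 add0r.
  rewrite inf_actionN /mulL tmapN opprK -/(mulL g.1.1 e (v g.1.2)) -mulR_Ad.
  by rewrite /mulR -tmapD addrC /inf_action_cochain addr0.
have cE x : (of_gpart v + of_tpart w) x =
    row_mx (mulR x.1.1 e (v x)) (w (tail x)).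
  by rewrite fctE /= add_row_mx addr0 add0r.
have S2 : \sum_(2 <= i < k.+2) (-1) ^+ i *:
      (of_gpart v + of_tpart w) (@gcontract R H i.-1 k g) =
    row_mx (mulR g.1.1 e (\sum_(2 <= i < k.+2) (-1) ^+ i *: v (@gcontract R H i.-1 k g)))
      (\sum_(2 <= i < k.+2) (-1) ^+ i *: w (tail (@gcontract R H i.-1 k g : T k.+1))).
  rewrite [X in row_mx X _]tmap_sum.
  under [X in row_mx X _]eq_bigr => i _ do rewrite tmapZ.
  rewrite -row_mx_sum big_nat [RHS]big_nat; apply: eq_bigr => i /andP[i2 ik].
  (* For i at least 2 the contraction leaves g_1 alone, so all terms of the sum are right translates
     by the same element. *)
  have F : (@gcontract R H i.-1 k g).1.1 = g.1.1.
    by case: i i2 ik => [|[|i]] // _; case: (k) g {Sg} => [|k'] g.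
  by rewrite cE F.
have D := rep_d_tail w Sg.
have {}D := congr1 (fun z => row_mx (0 : Vg) (rho v (g.2 : T k.+1) + z)) D.
refine (etrans _ (congr1 (fun z => of_gpart (rep_d (E := rep_g a) v) g - z) (esym D))).
case: g Sg S2 {D} => [[h1 x1] [[h2 x2] r]] Sg S2.
(* The strings starting with g_1 g_2 and with g_2 have the same tail, so the two vectors fed to
   [dmbar] share their M-component, as [dmbar_trivialized] requires. *)
have tE : tail (((lmul h1 h2, x2), r) : T k.+1) = tail (((h2, x2), r) : T k.+1).
  by case: (k) r {Sg S2}.
rewrite /def_d S2 !cE /= tE dmbar_trivialized.
rewrite scale_row_mx !opp_row_mx !add_row_mx.
rewrite subr0 sub0r; congr row_mx.
  rewrite /mulR -tmapN -tmapZ -!tmapD; congr (tmap _ _ _).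
  (* The term i = 1 of the sum in [rep_d] is split off: it comes from the division map, the sum in
     [def_d] starting at 2. *)
  by rewrite [in RHS]big_ltn// expr1 scaleN1r opprB !addrA.
rewrite /inf_action_cochain /=.
by rewrite !opprD !opprK !addrA.
Qed.

End ActionDifferentials.

(** * Smoothness and projectability of the components *)

Section ActionSmooth.
Context {R : realType} {G : lie_group R} {M : manifold R} (a : lie_action G M).
Local Notation aG := (manifold_atlas G).
Local Notation aM := (manifold_atlas M).
Local Notation aA := (@arr_atlas R G M).
Local Notation e := (lone G).
Local Notation H := (action_groupoid a).
Local Notation T := (nerve H).
Local Notation N := (fun n => Topological.sort (nerve H n)).
Local Notation Vg := 'rV[R]_(mdim G).
Local Notation Vt := 'rV[R]_(mdim M).
Local Notation Vd := 'rV[R]_(mdim G + mdim M).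
Local Notation rho := (@inf_action_cochain R G M a).
Local Notation TG := (tangent_bundle G).
Local Notation TM := (tangent_bundle M).
Local Notation TA := (tangent_bundle (prodm G M)).
Local Notation aN := (nerve_atlas a).

Lemma trivial_lin (P : charted R) n (x y : P) : linear (triv (trivial_bundle P n) x y).
Proof. by move=> b u v. Qed.

Lemma smooth_arr1 k (g : T k.+1) : smooth_at (fun h : T k.+1 => h.1 : prodm G M) g.
Proof. exact (smooth_at_fst aA (strings_atlas a k) g). Qed.

Lemma smooth_group1 k (g : T k.+1) : smooth_at (fun h : T k.+1 => h.1.1 : G) g.
Proof. exact (smooth_at_comp (aN k.+1) aA aG (smooth_arr1 g) (smooth_at_fst aG aM _)). Qed.

Lemma smooth_source1 k (g : T k.+1) : smooth_at (fun h : T k.+1 => h.1.2 : M) g.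
Proof. exact (smooth_at_comp (aN k.+1) aA aM (smooth_arr1 g) (smooth_at_snd aG aM _)). Qed.

Lemma smooth_target k (g : T k) : smooth_at (@target R H k) g.
Proof.
case: k g => [|k] g; first exact: smooth_at_id aM g.
exact (smooth_act a (aN k.+1) (smooth_group1 g) (smooth_source1 g)).
Qed.

Lemma smooth_tail k (g : T k.+1) : smooth_at (@tail R G M a k) g.
Proof.
case: k g => [|k] g; first exact: smooth_source1.
exact (smooth_at_snd aA (strings_atlas a k.+1) g).
Qed.

Lemma smooth_lift_unit k (g : T k) : smooth_at (@lift_unit R G M a k) g.
Proof.
have sl : @smooth_at R (T k) (prodm G M) (fun h => (e, target h)) g.
  exact (smooth_at_pair (aN k) aG aM (smooth_at_cst (aN k) aG e g) (smooth_target g)).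
case: k g sl => [|k] g sl.
  exact (smooth_at_pair aM aA (euclid_atlas 0) sl (smooth_at_cst aM (euclid_atlas 0) 0 g)).
exact (smooth_at_pair (aN k.+1) aA (strings_atlas a k.+1) sl (smooth_at_id (aN k.+1) g)).
Qed.

Lemma smooth_section_fst k (S : set (T k)) (f : T k -> prodm G M) c :
  (forall x, S x -> smooth_at f x) -> smooth_section TA S f c ->
  smooth_section TG S (fun g => (f g).1) (fun g => lsubmx (c g : Vd)).
Proof.
move=> sf sc; have := smooth_section_tmap (aN k) aA aG sf (smooth_at_fst aG aM) sc.
apply: smooth_section_eq => // g _; exact: tmap_fst aG aM _ _.
Qed.

Lemma smooth_section_snd k (S : set (T k)) (f : T k -> prodm G M) c :
  (forall x, S x -> smooth_at f x) -> smooth_section TA S f c ->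
  smooth_section TM S (fun g => (f g).2) (fun g => rsubmx (c g : Vd)).
Proof.
move=> sf sc; have := smooth_section_tmap (aN k) aA aM sf (smooth_at_snd aG aM) sc.
apply: smooth_section_eq => // g _; exact: tmap_snd aG aM _ _.
Qed.

(* Right translation by [h g], expressed through the multiplication map so that
   the translating element may vary smoothly. *)
Lemma smooth_section_mulR k (S : set (T k)) (f h : T k -> G) u :
  (forall x, S x -> smooth_at f x) -> (forall x, S x -> smooth_at h x) ->
  smooth_section TG S f u ->
  smooth_section TG S (fun g => lmul (f g) (h g)) (fun g => mulR (h g) (f g) (u g)).
Proof.
move=> sf sh su.
have s0 : smooth_section TG S h (fun=> 0).
  exact (smooth_section0 (aN k) h (@triv_tangentP R G)).
have sp := smooth_section_pair (aN k) aG aG sf sh su s0.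
have sfh x : S x -> @smooth_at R (T k) (prodm G G) (fun g => (f g, h g)) x.
  move=> Sx; exact (smooth_at_pair (aN k) aG aG (sf x Sx) (sh x Sx)).
have := smooth_section_tmap (aN k) (prodm_atlas aG aG) aG sfh (@lmul_smooth R G) sp.
apply: smooth_section_eq => // g Sg.
refine (etrans (tmap_partial aG aG aG _ _ (lmul_smooth (f g, h g))) _).
by rewrite tmap0 addr0.
Qed.

Lemma rep_g_adm k (v : T k -> Vg) :
  adm (c := rep_complex (rep_g a)) v <->
  smooth_section (trivial_bundle M (mdim G)) (@nset R H k) (@target R H k) v.
Proof. apply: (smooth_along_trivialP (aN k) aM) => x _; exact: smooth_target. Qed.

Lemma rep_g_adm_cst k (v : T k -> Vg) :
  adm (c := rep_complex (rep_g a)) v <->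
  smooth_section TG (@nset R H k) (fun=> e) v.
Proof. by rewrite rep_g_adm; split=> /(smooth_section_cst (aN k) aG). Qed.

Lemma rep_T_adm k (w : T k -> Vt) :
  adm (c := rep_complex (rep_T a)) w <->
  smooth_section TM (@nset R H k) (@target R H k) w.
Proof. apply: (smooth_along_tangentP (aN k) aM) => x _; exact: smooth_target. Qed.

Lemma smooth_unit (x : M) : @smooth_at R M (prodm G M) (fun x => (e, x)) x.
Proof. exact (smooth_at_pair aM aG aM (smooth_at_cst aM aG e x) (smooth_at_id aM x)). Qed.

Lemma def_adm0 (c : T 0%N -> Vd) :
  adm (c := def_complex H) c <->
  smooth_section TA setT (fun x : M => ((e, x) : prodm G M)) c /\
  forall x, rsubmx (c x) = 0.
Proof.
have E : smooth_along (tangent_bundle (arr H)) setT (@gu R H) c <->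
    smooth_section TA setT (fun x : M => ((e, x) : prodm G M)) c.
  by apply: (smooth_along_tangentP aM aA) => x _; exact: smooth_unit.
split=> [[/E sc c0]|[/E sc c0]]; split=> // x; rewrite -(c0 x).
  exact (esym (tmap_snd aG aM ((e, x) : prodm G M) (c x))).
exact (tmap_snd aG aM ((e, x) : prodm G M) (c x)).
Qed.

Lemma def_admS k (c : T k.+1 -> Vd) :
  adm (c := def_complex H) c <->
  smooth_section TA (@nset R H k.+1) (fun g => g.1) c /\
  forall g g' : T k.+1, nset g -> nset g' -> g.1.2 = g'.1.2 -> g.2 = g'.2 ->
    rsubmx (c g) = rsubmx (c g').
Proof.
have E : smooth_along (tangent_bundle (arr H)) (@nset R H k.+1) (fun g => g.1) c <->
    smooth_section TA (@nset R H k.+1) (fun g => g.1) c.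
  by apply: (smooth_along_tangentP (aN k.+1) aA) => x _; exact: smooth_arr1.
have F g : tmap (@gs R H) g.1 (c g) = rsubmx (c g).
  exact (tmap_snd aG aM (g.1 : prodm G M) (c g)).
split=> [[/E sc cs]|[/E sc cs]]; split=> // g g' Sg Sg' e1 e2.
  by rewrite -!F; exact: cs.
by rewrite !F; exact: cs.
Qed.

(** In positive degree the translated component lies over g g^-1 = e, so it is a smooth section
    along the constant map at the unit. *)
Lemma gpart_adm k (c : T k -> Vd) :
  adm (c := def_complex H) c -> adm (c := rep_complex (rep_g a)) (gpart c).
Proof.
case: k c => [|k] c.
  move=> /def_adm0[sc _]; apply/rep_g_adm_cst.
  have sl := smooth_section_fst (k := 0) (fun x _ => smooth_unit x) sc.
  have sz : smooth_section TG [set: M] (fun=> e) (fun=> 0).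
    exact (smooth_section0 aM (fun=> e) (@triv_tangentP R G)).
  have := smooth_section_lin aM (-1) (@triv_tangentP R G) sl sz.
  by apply: smooth_section_eq => // x _; rewrite scaleN1r addr0.
move=> /def_admS[sc _]; apply/rep_g_adm_cst.
have sl := smooth_section_fst (fun g _ => smooth_arr1 g) sc.
have := smooth_section_mulR (fun g _ => smooth_group1 g)
  (fun g _ => smooth_linv (aN k.+1) (smooth_group1 g)) sl.
by apply: smooth_section_eq => // g _; exact: lmulgV.
Qed.

(** The component is pulled back along [lift_unit], whose first arrow is a unit with source the
    target of the string; this is the base point required of a T M-valued cochain. *)
Lemma tpart_adm k (c : T k -> Vd) : adm (c := def_complex H) c ->
  shift_adm (T := N) (@adm _ (rep_complex (rep_T a))) (tpart c).
Proof.
case: k c => [//|k] c /def_admS[sc _]; apply/rep_T_adm.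
have sr := smooth_section_snd (fun g _ => smooth_arr1 g) sc.
have := smooth_section_pullback (aN k.+1) (aN k) (fun g _ => smooth_lift_unit g)
  (@nset_lift R G M a k) sr.
by apply: smooth_section_eq => //; case: k {c sc sr}.
Qed.

Lemma of_adm k (v : T k -> Vg) (w : T k.-1 -> Vt) :
  adm (c := rep_complex (rep_g a)) v ->
  shift_adm (T := N) (@adm _ (rep_complex (rep_T a))) w ->
  adm (c := def_complex H) (of_gpart v + of_tpart w).
Proof.
case: k v w => [|k] v w /rep_g_adm_cst sv Aw.
  apply/def_adm0; split; last by move=> x; rewrite fctE /= addr0 row_mxKr.
  have sz := smooth_section0 (S := [set: M]) aM (fun x : M => x) (@triv_tangentP R M).
  have sz' : smooth_section TG [set: M] (fun=> e) (fun=> 0).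
    exact (smooth_section0 aM (fun=> e) (@triv_tangentP R G)).
  have sn := smooth_section_lin aM (-1) (@triv_tangentP R G) sv sz'.
  have := smooth_section_pair aM aG aM (fun x _ => smooth_at_cst aM aG e x)
    (fun x _ => smooth_at_id aM x) sn sz.
  by apply: smooth_section_eq => // x _; rewrite fctE /= addr0 scaleN1r addr0.
have cE (x : T k.+1) : (of_gpart v + of_tpart w) x =
    row_mx (mulR x.1.1 e (v x)) (w (tail x)).
  by rewrite fctE /= add_row_mx addr0 add0r.
apply/def_admS; split; last first.
  move=> g g' _ _ e1 e2; rewrite !cE !row_mxKr; congr w.
  by case: (k) g g' e1 e2.
have sm := smooth_section_mulR (fun g _ => smooth_at_cst (aN k.+1) aG e g)
  (fun g _ => smooth_group1 g) sv.
move/rep_T_adm: Aw => sw.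
have st := smooth_section_pullback (aN k) (aN k.+1) (fun g _ => smooth_tail g)
  (@nset_tail R G M a k) sw.
have := smooth_section_pair (aN k.+1) aG aM
  (fun g _ => smooth_lmul (aN k.+1) (smooth_at_cst (aN k.+1) aG e g) (smooth_group1 g))
  (fun g _ => smooth_at_comp (aN k.+1) (aN k) aM (smooth_tail g) (smooth_target (tail g)))
  sm st.
apply: smooth_section_eq => g Sg; last by rewrite cE.
(* The pair of base points is (e g, x) with x the target of the tail, that is the source of g_1; it
   is therefore g_1 itself. *)
by rewrite lmul1g target_tail//; case: (g.1).
Qed.

Lemma def_dec k (c : T k -> Vd) g : adm (c := def_complex H) c -> nset g ->
  c g = of_gpart (gpart c) g + of_tpart (tpart c) g.
Proof.
case: k c g => [|k] c g.
  move=> /def_adm0[_ c0] _; rewrite /= addr0 opprK -(c0 g).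
  by rewrite hsubmxK.
move=> /def_admS[_ cs] Sg; have [e1 e2] := lift_tail Sg.
rewrite /= add_row_mx addr0 add0r mulRVK.
rewrite -(cs g _ Sg (nset_lift (nset_tail Sg)) e1 e2).
by rewrite hsubmxK.
Qed.

(** [rho v] is the differential of the action map applied to the smooth field (v, 0) over the points
    (e, target), which the action sends back to the target. *)
Lemma inf_action_cochain_adm k (v : T k -> Vg) :
  adm (c := rep_complex (rep_g a)) v -> adm (c := rep_complex (rep_T a)) (rho v).
Proof.
move=> /rep_g_adm_cst sv; apply/rep_T_adm.
have sz := smooth_section0 (S := @nset R H k) (aN k) (@target R H k) (@triv_tangentP R M).
have sp := smooth_section_pair (aN k) aG aM (fun g _ => smooth_at_cst (aN k) aG e g)
  (fun g _ => smooth_target g) sv sz.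
have sf (g : T k) : nset g -> @smooth_at R (T k) (prodm G M) (fun g => (e, target g)) g.
  by move=> _; exact (smooth_at_pair (aN k) aG aM (smooth_at_cst (aN k) aG e g) (smooth_target g)).
have := smooth_section_tmap (aN k) aA aM sf (lact_smooth a) sp.
by apply: smooth_section_eq => // g _; exact: lact1.
Qed.

Lemma def_adm_eq k (u v : T k -> Vd) : (forall g, nset g -> u g = v g) ->
  adm (c := def_complex H) u -> adm (c := def_complex H) v.
Proof.
case: k u v => [|k] u v uv; first by have -> : u = v by apply/funext => x; exact: uv.
move=> /def_admS[su uc]; apply/def_admS; split; first exact: smooth_section_eq su.
by move=> g g' Sg Sg' e1 e2; rewrite -!uv//; exact: uc.
Qed.

Lemma rep_g_adm_lin k b (u v : T k -> Vg) :
  adm (c := rep_complex (rep_g a)) u -> adm (c := rep_complex (rep_g a)) v ->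
  adm (c := rep_complex (rep_g a)) (b *: u + v).
Proof.
move=> /rep_g_adm su /rep_g_adm sv; apply/rep_g_adm.
exact (smooth_section_lin (aN k) b (@trivial_lin M _) su sv).
Qed.

Lemma rep_T_adm_lin k b (u v : T k -> Vt) :
  adm (c := rep_complex (rep_T a)) u -> adm (c := rep_complex (rep_T a)) v ->
  adm (c := rep_complex (rep_T a)) (b *: u + v).
Proof.
move=> /rep_T_adm su /rep_T_adm sv; apply/rep_T_adm.
exact (smooth_section_lin (aN k) b (@triv_tangentP R M) su sv).
Qed.

Lemma rep_g_adm_0 k : adm (c := rep_complex (rep_g a)) (0 : T k -> Vg).
Proof.
by apply/rep_g_adm; exact (smooth_section0 (aN k) (@target R H k) (@trivial_lin M _)).
Qed.

Lemma rep_T_adm_0 k : adm (c := rep_complex (rep_T a)) (0 : T k -> Vt).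
Proof.
by apply/rep_T_adm; exact (smooth_section0 (aN k) (@target R H k) (@triv_tangentP R M)).
Qed.

End ActionSmooth.

Local Close Scope ring_scope.
Local Close Scope classical_set_scope.

Theorem proposition3p5 (R : realType) (G : lie_group R) (M : manifold R)
    (a : lie_action G M) :
  let Cdef := def_complex (action_groupoid a) in
  let Cg := rep_complex (rep_g a) in
  let CT := rep_complex (rep_T a) in
  exists (iota : forall k : nat, coh CT k -> coh Cdef k.+1)
         (pi : forall k : nat, coh Cdef k -> coh Cg k)
         (rho : forall k : nat, coh Cg k -> coh CT k),
    (forall k : nat, coh_linear (iota k) /\ coh_linear (pi k) /\
                     coh_linear (rho k)) /\
    (forall k : nat, coh_induced (@inf_action_cochain R G M a k) (rho k)) /\
    (forall x : coh Cdef 0, coh_is0 (pi 0%N x) <-> coh_is0 x) /\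
    (forall k : nat, coh_exact (iota k) (pi k.+1)) /\
    (forall k : nat, coh_exact (pi k) (rho k)) /\
    (forall k : nat, coh_exact (rho k) (iota k)).
Proof.
have linA (g : arr (action_groupoid a)) b u v :
    @gact R (action_groupoid a) (rep_g a) g (b *: u + v)%R =
    (b *: @gact R (action_groupoid a) (rep_g a) g u +
     @gact R (action_groupoid a) (rep_g a) g v)%R by exact: linearP.
have linT (g : arr (action_groupoid a)) b u v :
    @gact R (action_groupoid a) (rep_T a) g (b *: u + v)%R =
    (b *: @gact R (action_groupoid a) (rep_T a) g u +
     @gact R (action_groupoid a) (rep_T a) g v)%R by exact: linearP.
exact (cone_long_exact (@rep_g_adm_0 R G M a) (@rep_T_adm_0 R G M a) (@rep_g_adm_lin R G M a)
  (@rep_T_adm_lin R G M a) (@def_adm_eq R G M a)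
  (fun k => rep_d_lin (k := k) linA) (fun k => rep_d_lin (k := k) linT)
  (@of_gpart_lin R G M a) (@of_tpart_lin R G M a) (@gpart_lin R G M a)
  (@tpart_lin R G M a) (@inf_action_cochain_lin R G M a)
  (@def_d_local R G M a) (@of_gpart_local R G M a) (@of_tpart_local R G M a)
  (@gpart_local R G M a) (@tpart_local R G M a) (@inf_action_cochain_local R G M a)
  (@inf_action_cochain_adm R G M a) (@gpart_adm R G M a) (@tpart_adm R G M a)
  (@of_adm R G M a) (fun k c Ac g => @def_dec R G M a k c g Ac) (fun k v w g _ => gpart_of v w g)
  (fun k v w g _ => tpart_of v w g) (@def_d_of R G M a) (@inf_action_cochain_d R G M a)).
Qed.
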